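(* For every integer $k \geq 2$, $$\eta(q)^{2k^2-k}=C_{k}\sum_{{\bf n}\in\mathbb{Z}^k}(-1)^{\sum_{i=1}^k n_i}\,\chi_D({\bf n})\,q^{L({\bf n})},$$ where for ${\bf n}=(n_1,\ldots,n_k)\in\mathbb{Z}^k$ $$L({\bf n})=\frac{2k^2-k}{24}+\sum_{i=1}^k\left(\frac{(2k+1)n_i^2}{2}+\frac{(2i-1)n_i}{2}\right),$$ $$\chi_D({\bf n})=\prod_{1\leq i<j\leq k}\left\{(2i-1+n_i(4k+2))^2-(2j-1+n_j(4k+2))^2\right\},$$ and $$C_k=\frac{1}{2^{k(k-1)}\prod_{1\leq i<j\leq k}(i-j)(i+j-1)}.$$
   Context: Here $q=e^{2\pi i\tau}$ with $\tau$ in the upper half-plane $\mathbb{H}$, rational powers are $q^x=e^{2\pi i\tau x}$, and $\eta(q)=q^{1/24}\prod_{i\geq1}(1-q^i)$ is the Dedekind $\eta$-function. *)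

(* Defs.v *)
From HB Require Import structures.
From mathcomp Require Import all_boot all_order all_algebra.
From mathcomp Require Import finmap complex.
From mathcomp Require Import all_classical all_reals all_analysis.

Set Implicit Arguments.
Unset Strict Implicit.
Unset Printing Implicit Defensive.

Import Order.TTheory GRing.Theory Num.Theory.
Import numFieldNormedType.Exports.

Local Open Scope classical_set_scope.
Local Open Scope complex_scope.
Local Open Scope ring_scope.

(* [R[i]] seen as a [numFieldType], which is what triggers the inheritance of
   the norm topology; [R[i]] alone carries no topological structure. *)
Definition CC (R : realType) : numFieldType := R[i].

Section UnconditionalSum.
Variable I : choiceType.

(* Finite subsets of [I] ordered by inclusion: convergence along [totally] of
   the finite partial sums is unconditional summation over [I]. *)
Definition totally : set_system {fset I} :=
  filter_from setT (fun A : {fset I} => [set B : {fset I} | fsubset A B]).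

#[global] Instance totally_filter : ProperFilter totally.
Proof.
apply: filter_from_proper; last by move=> A _; exists A => /=.
apply: filter_from_filter; first by exists fset0.
move=> A B _ _; exists (A `|` B)%fset => // C /=.
by rewrite fsubUset => /andP[].
Qed.

Definition partial_sum (V : nmodType) (f : I -> V) (A : {fset I}) : V :=
  \sum_(i <- A) f i.

Definition csummable (R : realType) (f : I -> CC R) : Prop :=
  cvg (partial_sum f @ totally).

Definition csum (R : realType) (f : I -> CC R) : CC R :=
  lim (partial_sum f @ totally).

End UnconditionalSum.

Section Eta.
Variable R : realType.

Definition cexp (z : R[i]) : CC R :=
  (expR (complex.Re z))%:C *
  (cos (complex.Im z) +i* sin (complex.Im z)).

Definition qpow (tau : R[i]) (x : rat) : CC R :=
  cexp ((0 +i* (2 * pi)) * tau * ratr x).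

Definition eta_prod (tau : R[i]) (m : nat) : CC R :=
  \prod_(1 <= i < m.+1) (1 - qpow tau i%:R).

Definition eta (tau : R[i]) : CC R :=
  qpow tau 24^-1 * lim (eta_prod tau @ \oo).

End Eta.

Section Combinatorics.
Variable k : nat.

(* The mathematical index 1, ..., k of [i : 'I_k], which starts at 0. *)
Definition idx (i : 'I_k) : int := i.+1%:Z.

Definition L (n : {ffun 'I_k -> int}) : rat :=
  (2 * k%:R ^+ 2 - k%:R) / 24 +
  \sum_(i < k) ((2 * k%:R + 1) * (n i)%:~R ^+ 2 / 2
                + (2 * (idx i)%:~R - 1) * (n i)%:~R / 2).

Definition chiD (n : {ffun 'I_k -> int}) : int :=
  \prod_(i < k) \prod_(j < k | (i < j)%N)
    ((2 * idx i - 1 + n i * (4 * k%:Z + 2)) ^+ 2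
     - (2 * idx j - 1 + n j * (4 * k%:Z + 2)) ^+ 2).

Definition Ck : rat :=
  (2 ^+ (k * (k - 1))%N *
   \prod_(i < k) \prod_(j < k | (i < j)%N)
     ((idx i - idx j) * (idx i + idx j - 1))%:~R)^-1.

End Combinatorics.

(* Main.v *)
Require Import Defs.
From mathcomp Require Import all_boot all_order all_algebra.
From mathcomp Require Import complex.
From mathcomp Require Import all_classical all_reals all_analysis.
From mathcomp Require Import perm finmap zify ring.
Import Order.TTheory GRing.Theory Num.Theory.
Import numFieldNormedType.Exports.
Local Open Scope ring_scope.

Set Implicit Arguments.
Unset Strict Implicit.
Unset Printing Implicit Defensive.

(** Write a_i(n) = 2i - 1 + n(4k + 2) for 1 <= i <= k.  The exponent
    e_i(n) = ((2k+1) n^2 + (2i-1) n) / 2 satisfies a_i(n)^2 = 8(2k+1) e_i(n) + (2i-1)^2,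
    so the series
        f_(i,j) = sum over n in Z of (-1)^n a_i(n)^j q^(e_i(n))
    satisfy the heat equation 8(2k+1) q f_(i,j)' + (2i-1)^2 f_(i,j) = f_(i,j+2).  By
    Vandermonde, the sum over Z^k in the theorem is, up to a sign and a power of q, the
    determinant W of the f_(i,2j), 0 <= j < k: the Wronskian of k theta functions.

    Adding a multiple of W to 8(2k+1) q W' gives the determinant W2 whose last row, of
    exponent 2k-2, is replaced by the row of exponent 2k.  For even j the f_(i,j) are the
    derivatives of order j at x = 1, for x d/dx and up to scalars, of a basis of the even
    theta functions of degree 2k+1 in x, and this space also contains
        b(x) = theta(x^2) theta(x)^(2k-3),
        theta(x) = sum over n in Z of (-1)^n q^(n(n-1)/2) x^(n-1/2),
    because b has the right behaviour under x -> 1/x and x -> qx (moment_poly_span).  As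
    theta is odd in log x, b vanishes to order 2k-2 at x = 1; its next two even
    derivatives u, v are in a ratio fixed by those of theta (vanishing_mul_theta).  A
    combination of the basis thus has derivatives 0, ..., 0, u, v, which forces
    u W2 = v W (wronskian_relation).

    With the heat equation of theta this becomes 3 A q W' = k(2k-1) q A' W, where A is
    the sum of (-1)^n (2n-1) q^(n(n-1)/2).  Jacobi's identity A = -2 prod (1 - q^i)^3
    (jacobi_cube) then says that W and the power k(2k-1) of prod (1 - q^i) have the same
    logarithmic derivative, so they agree up to W(0), which is 1/C_k up to the sign
    above (Ck_discr0).

    Series in q are handled as polynomials modulo X^M, Laurent series in x over them as
    functions of the two exponents.  Restricting n to the box |n_i| <= M turns W into a
    polynomial W_M, congruent modulo X^M to W(0) prod_(i <= M) (1 - X^i)^(k(2k-1))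
    (box_poly_eta).  At X = q, W_M is a finite partial sum of the series in the theorem,
    up to a sign and a power of q.  A coefficientwise majorant makes the error at most a
    constant times t^M with t < 1 (box_estimate), and the same majorant bounds the terms
    outside the box (lattice_term_tail); together they give unconditional convergence and
    the limit. *)

(** * Finitely supported sums over the integers *)
Section IntegerSums.
Variable F : numFieldType.

Definition zbox (K : nat) : seq int := [seq i%:Z - K%:Z | i <- iota 0 (K + K).+1].

Lemma mem_zbox K n : (n \in zbox K) = (`|n| <= K)%N.
Proof.
apply/mapP/idP => hn; first by case: hn => i; rewrite mem_iota => ? ->; lia.
exists (absz (n + K%:Z)); last by lia.
by rewrite mem_iota; lia.
Qed.

Lemma zbox_uniq K : uniq (zbox K).
Proof. by rewrite map_inj_uniq ?iota_uniq // => i j; lia. Qed.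

Definition zsum (f : int -> F) : F := \sum_(n \in [set: int]) f n.

(** Reindexing holds for zsum by any bijection, with no bound on the support; this
    lemma is the way back to an ordinary finite sum, once a bound is known. *)
Lemma zsumE K f : (forall n, (K < `|n|)%N -> f n = 0) ->
  zsum f = \sum_(n <- zbox K) f n.
Proof.
move=> f0; rewrite /zsum (fsbigE (zbox K)) ?zbox_uniq //.
  by apply: eq_bigl => n; rewrite in_setT.
by move=> n _; rewrite mem_zbox -ltnNge; apply: f0.
Qed.

Lemma eq_zsum f g : f =1 g -> zsum f = zsum g.
Proof. by move=> /funext ->. Qed.

Lemma zsum_reindex h f : bijective h -> zsum f = zsum (f \o h).
Proof. exact: reindex_fsbigT. Qed.

Lemma zsumZ a f : zsum (fun n => a * f n) = a * zsum f.
Proof. by rewrite /zsum mulr_fsumr. Qed.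

Lemma zsum_shift m f : zsum f = zsum (fun n => f (n + m)).
Proof.
by apply: zsum_reindex; exists (fun n => n - m) => n; rewrite ?addrK ?subrK.
Qed.

Lemma zsum_reflect m f : zsum f = zsum (fun n => f (m - n)).
Proof. by apply: zsum_reindex; exists (fun n => m - n) => n; ring. Qed.

Lemma zsum0 f : (forall n, f n = 0) -> zsum f = 0.
Proof. by move=> f0; rewrite (@zsumE 0%N) // big1. Qed.

Lemma zsum_neq0 f : zsum f != 0 -> exists n, f n != 0.
Proof.
move=> h; apply: contrapT => hn; move/eqP: h; apply; apply: zsum0 => n.
by apply: contrapT => fn; apply: hn; exists n; apply/eqP.
Qed.

Lemma sgnD m n : (-1) ^ (m + n) = (-1) ^ m * (-1) ^ n :> F.
Proof. by rewrite expfzDr // oppr_eq0 oner_eq0. Qed.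

Lemma sgnN n : (-1) ^ (- n) = (-1) ^ n :> F.
Proof. by rewrite -exprz_inv invrN invr1. Qed.

Lemma sgnSq n : (-1) ^ n * (-1) ^ n = 1 :> F.
Proof. by rewrite -{2}sgnN -sgnD addrN expr0z. Qed.

Lemma norm_sgn n : `|(-1) ^ n : F| = 1.
Proof. by case: n => n; rewrite /exprz ?normfV normrX normrN1 expr1n ?invr1. Qed.
End IntegerSums.

Section IntegerSumsExchange.
Variable F : numFieldType.

Lemma zsum_sum (I : Type) (s : seq I) (K : nat) (f : I -> int -> F) :
  (forall i l, (K < `|l|)%N -> f i l = 0) ->
  zsum (fun l => \sum_(i <- s) f i l) = \sum_(i <- s) zsum (f i).
Proof.
move=> f0; rewrite (@zsumE _ K); last by move=> l /f0 h; rewrite big1.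
rewrite exchange_big; apply: eq_bigr => i _; rewrite (@zsumE _ K) // => l.
exact: f0.
Qed.

(** Summing over one residue class modulo b: the class of rho is parametrised by
    n |-> rho + b n. *)
Lemma zsum_residue (b rho : int) (h : int -> F) : b != 0 ->
  zsum (fun n => h (rho + b * n)) =
  zsum (fun l => if (b %| l - rho)%Z then h l else 0).
Proof.
move=> b0; rewrite /zsum.
have -> : \sum_(l \in [set: int]) (if (b %| l - rho)%Z then h l else 0) =
    \sum_(l \in [set l | (b %| l - rho)%Z]) h l.
  rewrite [RHS]fsbig_mkcond; apply: eq_fsbigr => l _; rewrite /patch.
  case: (boolP (b %| l - rho)%Z) => hl;
    [by rewrite mem_set | by rewrite memNset //=; exact/negP].
apply/esym/(reindex_fsbig (fun n => rho + b * n)).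
split.
- by move=> n _ /=; apply/dvdzP; exists n; ring.
- by move=> m n _ _ /addrI /(mulfI b0).
- by move=> l /= /dvdzP[n hn]; exists n => //; rewrite mulrC -hn; ring.
Qed.
End IntegerSumsExchange.

Definition tri (n : int) : nat := absz ((n * (n - 1)) %/ 2)%Z.

Lemma even_mulz_pred n : (2 %| n * (n - 1))%Z.
Proof.
have := divz_eq n 2; have := ltz_pmod n (isT : 0 < 2 :> int);
  have := modz_ge0 n (isT : 2 != 0 :> int).
set m := (n %/ 2)%Z; set r := (n %% 2)%Z => r0 r2 ->.
have [->|->] : r = 0 \/ r = 1 by lia.
  by apply/dvdzP; exists (m * (m * 2 - 1)); ring.
by apply/dvdzP; exists (m * (m * 2 + 1)); ring.
Qed.

Lemma tri_eq n : (tri n)%:Z * 2 = n * (n - 1).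
Proof.
have h : 0 <= n * (n - 1) by nia.
by rewrite /tri gez0_abs ?divz_ge0 // divzK ?even_mulz_pred.
Qed.

Lemma triD n r : (tri (n + r))%:Z = (tri n)%:Z + r * n + (tri r)%:Z.
Proof. have := tri_eq n; have := tri_eq r; have := tri_eq (n + r); nia. Qed.

Lemma tri_reflect n : tri (1 - n) = tri n.
Proof. have := tri_eq n; have := tri_eq (1 - n); nia. Qed.

Lemma tri_ge n : (absz n <= tri n + 1)%N.
Proof. have := tri_eq n; nia. Qed.

Lemma tri_odd_ge n : (absz (2 * n - 1)%R <= 2 * tri n + 1)%N.
Proof. have := tri_eq n; nia. Qed.

(** * Multiplication by theta functions *)
Section ThetaOperator.
Variable F : numFieldType.
Implicit Type G : int -> int -> F.

(** A function G of two integers stands for the Laurent series with coefficient G e l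
    at q^e x^(l/2); l is the doubled exponent because theta has half-integral ones.
    This condition makes every coefficient of q^e a Laurent polynomial in x, and
    negative powers of q absent. *)
Definition bounded (c : int) G :=
  forall e l, G e l != 0 -> 0 <= e /\ (absz l)%:Z <= c * (e + 1).

(** The product of G by theta(x^r). *)
Definition mul_theta (r : int) G (e l : int) : F :=
  zsum (fun n => (-1) ^ n * G (e - (tri n)%:Z) (l - r * (2 * n - 1))).

Definition odd_supported (p : int) G :=
  forall e l, G e l != 0 -> (2 %| l - p)%Z.

Definition parity (eps : F) G := forall e l, G e (- l) = eps * G e l.

(** Coefficientwise form of eps G(qx) = q^(-d/2) x^(-d) G(x): shifting the exponent of
    x by d costs the factor q^((l+d)/2).  The integer s is half of l + d, so nothing
    is claimed when l + d is odd. *)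
Definition quasi_periodic (d : int) (eps : F) G :=
  forall e l s, 2 * s = l + d -> G (e + s) (l + 2 * d) = eps * G e l.

Lemma bounded_translate (r c : int) G e l n : 0 <= r -> 0 <= c -> bounded c G ->
  G (e - (tri n)%:Z) (l - r * (2 * n - 1)) != 0 ->
  (tri n)%:Z <= e /\ (absz l)%:Z <= (c + 2 * r) * (e + 1).
Proof.
move=> r0 c0 bG /bG[h1 h2]; have := tri_odd_ge n; split; first lia.
have h3 : (absz l)%:Z <= (absz (l - r * (2 * n - 1))%R)%:Z + r * (absz (2 * n - 1)%R)%:Z.
  by nia.
have h4 : r * (absz (2 * n - 1)%R)%:Z <= r * (2 * (tri n)%:Z + 1) by nia.
nia.
Qed.

Lemma bounded_mul_theta (r c : int) G : 0 <= r -> 0 <= c -> bounded c G ->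
  bounded (c + 2 * r) (mul_theta r G).
Proof.
move=> r0 c0 bG e l /zsum_neq0[n]; rewrite mulf_eq0 negb_or => /andP[_].
by move=> /(bounded_translate r0 c0 bG)[h1 h2]; split=> //; lia.
Qed.

Lemma odd_supported_mul_theta (r p : int) G : odd_supported p G ->
  odd_supported (p + r) (mul_theta r G).
Proof.
move=> oG e l /zsum_neq0[n]; rewrite mulf_eq0 negb_or => /andP[_ /oG].
move=> /dvdzP[x hx]; apply/dvdzP; exists (x + r * n - r).
by move: hx; nia.
Qed.

(** theta(1/x) = - theta(x), from n |-> 1 - n in its defining sum. *)
Lemma parity_mul_theta r eps G : parity eps G -> parity (- eps) (mul_theta r G).
Proof.
move=> pG e l; rewrite /mul_theta (zsum_reflect 1) -zsumZ; apply: eq_zsum => n.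
rewrite tri_reflect sgnD sgnN expr1z.
have -> : - l - r * (2 * (1 - n) - 1) = - (l - r * (2 * n - 1)) by ring.
by rewrite pG; ring.
Qed.

(** The degree of theta(x^r) is r^2 and its multiplier (-1)^r, from n |-> n + r in its
    defining sum; degrees add and multipliers multiply. *)
Lemma quasi_periodic_mul_theta r d eps G : quasi_periodic d eps G ->
  quasi_periodic (d + r ^+ 2) ((-1) ^ r * eps) (mul_theta r G).
Proof.
move=> qG e l s hs; rewrite /mul_theta (zsum_shift r) -zsumZ; apply: eq_zsum => n.
have -> : e + s - (tri (n + r))%:Z =
  (e - (tri n)%:Z) + (s - r * n - (tri r)%:Z) by rewrite triD; ring.
have -> : l + 2 * (d + r ^+ 2) - r * (2 * (n + r) - 1) =
  (l - r * (2 * n - 1)) + 2 * d by ring.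
rewrite qG; first by rewrite sgnD; ring.
by have := tri_eq r; nia.
Qed.

Definition unit_series (e l : int) : F := ((e == 0) && (l == 0))%:R.

Lemma unit_seriesP e l : unit_series e l != 0 -> e = 0 /\ l = 0.
Proof.
rewrite /unit_series; have [->|] := eqVneq e 0; last by rewrite eqxx.
by have [->|] := eqVneq l 0; last by rewrite eqxx.
Qed.

End ThetaOperator.

(** * Power series modulo X^M *)
Section TruncatedSeries.
Variable F : numFieldType.
Implicit Types (M : nat) (phi : int -> F) (p q : {poly F}).

Definition trunc M phi : {poly F} := \poly_(e < M) phi e%:Z.

Definition lattice_poly (s : seq int) (w : int -> F) (E : int -> nat) : {poly F} :=
  \sum_(n <- s) w n *: 'X^(E n).

Lemma dvdXnP M p : reflect (forall e, (e < M)%N -> p`_e = 0) ('X^M %| p).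
Proof.
apply: (iffP idP) => [/dvdpP[q ->] e eM | h]; first by rewrite coefMXn eM.
rewrite -(poly_take_drop M p) dvdp_addl ?dvdp_mull //.
suff -> : take_poly M p = 0 by rewrite dvdp0.
by apply/polyP => e; rewrite coef_take_poly coef0; case: ifP => // /h.
Qed.

Lemma dvdp_sum (I : Type) (s : seq I) (P : pred I) (f : I -> {poly F}) d :
  (forall i, P i -> d %| f i) -> d %| \sum_(i <- s | P i) f i.
Proof. by move=> h; elim/big_rec: _ => [|i x Pi dx]; rewrite ?dvdp0 ?dvdp_add ?h. Qed.

(** A polynomial with nonzero constant term is a unit modulo X^M. *)
Lemma dvdXn_cancel M (u p : {poly F}) : u`_0 != 0 -> 'X^M %| u * p -> 'X^M %| p.
Proof.
move=> u0; rewrite Gauss_dvdpr // coprimep_expl // coprimep_sym.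
by rewrite -[X in coprimep _ X]subr0 -[0 in X in coprimep _ X]polyC0 coprimep_XsubC rootE horner_coef0.
Qed.

Lemma coef_lattice_poly s w E e :
  (lattice_poly s w E)`_e = \sum_(n <- s) w n * (e == E n)%:R.
Proof. by rewrite coef_sum; apply: eq_bigr => n _; rewrite coefZ coefXn. Qed.

Lemma coef_lattice_poly_trunc M s w E phi e :
  (forall x, x < 0 -> phi x = 0) -> (e < M)%N ->
  (lattice_poly s w E * trunc M phi)`_e =
  \sum_(n <- s) w n * phi (e%:Z - (E n)%:Z).
Proof.
move=> phi0 eM; rewrite mulr_suml coef_sum; apply: eq_bigr => n _.
rewrite -scalerAl coefZ coefXnM; case: ltnP => h.
  by rewrite phi0 // subr_lt0.
by rewrite coef_poly ifT ?(leq_ltn_trans (leq_subr _ _)) // subzn.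
Qed.

(** Up to the factor 2^j, the j-th derivative of theta at x = 1 for x d/dx. *)
Definition theta_moment M j : {poly F} :=
  lattice_poly (zbox M) (fun n => (-1) ^ n * (2 * n - 1)%:~R ^+ j) tri.

(** theta is odd in log x.  This holds only modulo X^M, as the box is not stable under
    n |-> 1 - n; the terms that this exchange moves out of the box have order at
    least M. *)
Lemma theta_moment_even M j : ~~ odd j -> 'X^M %| theta_moment M j.
Proof.
move=> jo; apply/dvdXnP => e eM; rewrite coef_lattice_poly.
pose f n : F := (-1) ^ n * (2 * n - 1)%:~R ^+ j * (e == tri n)%:R.
rewrite -(@zsumE _ M f); last first.
  move=> n hn; rewrite /f; case: eqP; rewrite ?mulr0 // => he.
  by have := tri_ge n; lia.
apply/eqP; rewrite -[_ == 0](mulrn_eq0 _ 2) mulr2n {2}(zsum_reflect 1).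
suff -> : zsum (fun n => f (1 - n)) = -1 * zsum f by rewrite mulN1r subrr.
rewrite -zsumZ; apply: eq_zsum => n; rewrite /f tri_reflect sgnD sgnN expr1z.
have -> : 2 * (1 - n) - 1 = - (2 * n - 1) :> int by ring.
by rewrite mulrNz exprNn -signr_odd (negbTE jo); ring.
Qed.

Lemma X_deriv_monomial (a : F) t :
  'X * (a *: 'X^t)^`() = (t%:R * a) *: 'X^t :> {poly F}.
Proof.
rewrite derivZ derivXn -scalerAr [_%:R * a]mulrC -scalerA; congr (_ *: _).
case: t => [|t]; first by rewrite scaler_nat !mulr0n mulr0.
by rewrite /= mulrnAr -exprS scaler_nat.
Qed.

Lemma lattice_poly_heat s w E (c : F) :
  c *: ('X * (lattice_poly s w E)^`()) =
  lattice_poly s (fun n => c * (E n)%:R * w n) E.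
Proof.
rewrite /lattice_poly raddf_sum mulr_sumr scaler_sumr.
by apply: eq_bigr => n _; rewrite /= X_deriv_monomial scalerA mulrA.
Qed.

(** (2n-1)^2 = 8 n(n-1)/2 + 1. *)
Lemma theta_moment_heat M j : 8%:R *: ('X * (theta_moment M j)^`()) + theta_moment M j = theta_moment M j.+2.
Proof.
rewrite lattice_poly_heat -big_split; apply: eq_bigr => n _ /=.
rewrite -scalerDl; congr (_ *: _).
have h : 8%:R * (tri n)%:R + 1 = (2 * n - 1)%:~R ^+ 2 :> F.
  rewrite -[(tri n)%:R]/((tri n)%:Z%:~R) -rmorphXn /=.
  have -> : (2 * n - 1) ^+ 2 = 8 * (tri n)%:Z + 1 by have := tri_eq n; lia.
  by rewrite rmorphD rmorphM.
by rewrite -[j.+2]addn2 exprD -h; ring.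
Qed.

End TruncatedSeries.

(** * Derivatives at the origin of a product of theta functions *)
Section Moments.
Variable F : numFieldType.
Implicit Type G : int -> int -> F.

(** Up to the factor 2^j, the j-th derivative at x = 1 of the coefficient of q^e. *)
Definition moment (j : nat) G (e : int) : F := zsum (fun l => G e l * l%:~R ^+ j).

Lemma moment_neg (c : int) j G e : bounded c G -> e < 0 -> moment j G e = 0.
Proof.
move=> bG e0; apply: zsum0 => l; apply/eqP; rewrite mulf_eq0; apply/orP; left.
by apply/negPn/negP => /bG[]; lia.
Qed.

Lemma eq0_contra (x : F) : (x != 0 -> False) -> x = 0.
Proof. by move=> h; apply/eqP/negPn/negP. Qed.

(** Leibniz rule for the product by theta(x^r): the exponents of x add, and (l + l')^j is
    expanded by the binomial formula. *)
Lemma moment_mul_theta (r c : int) j G e N : 0 <= r -> 0 <= c -> bounded c G ->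
  e < N%:Z ->
  moment j (mul_theta r G) e =
  \sum_(i < j.+1) ('C(j, i)%:R * r%:~R ^+ i) *
    \sum_(n <- zbox N) ((-1) ^ n * (2 * n - 1)%:~R ^+ i) *
       moment (j - i) G (e - (tri n)%:Z).
Proof.
move=> r0 c0 bG eN.
pose B : nat := absz ((c + 2 * r) * (e + 1)).
pose f n l : F := (-1) ^ n * (G (e - (tri n)%:Z) (l - r * (2 * n - 1)) * l%:~R ^+ j).
have fB n l : (B < absz l)%N -> f n l = 0.
  move=> hl; apply: eq0_contra; rewrite !mulf_eq0 !negb_or => /and3P[_ h _].
  by have [h1 h2] := bounded_translate r0 c0 bG h; nia.
have -> : moment j (mul_theta r G) e = zsum (fun l => \sum_(n <- zbox N) f n l).
  apply: eq_zsum => l; rewrite /mul_theta (@zsumE _ N) => [|n hn].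
    by rewrite mulr_suml; apply: eq_bigr => n _; rewrite /f mulrA.
  apply: eq0_contra; rewrite mulf_eq0 negb_or => /andP[_ h].
  have [h1 h2] := bounded_translate r0 c0 bG h; have := tri_ge n; lia.
rewrite (zsum_sum _ fB).
have fE n : zsum (f n) = (-1) ^ n * \sum_(i < j.+1)
    ('C(j, i)%:R * (r * (2 * n - 1))%:~R ^+ i) * moment (j - i) G (e - (tri n)%:Z).
  rewrite zsumZ (zsum_shift (r * (2 * n - 1))); congr (_ * _).
  pose g (i : 'I_j.+1) l : F :=
    ('C(j, i)%:R * (r * (2 * n - 1))%:~R ^+ i) * (G (e - (tri n)%:Z) l * l%:~R ^+ (j - i)).
  transitivity (zsum (fun l => \sum_(i < j.+1) g i l)).
    apply: eq_zsum => l; rewrite addrK rmorphD exprDn mulr_sumr.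
    by apply: eq_bigr => i _; rewrite /g -mulr_natr; ring.
  rewrite (@zsum_sum _ _ _ (absz (c * (e + 1)))).
    by apply: eq_bigr => i _; rewrite zsumZ.
  move=> i l hl; apply: eq0_contra; rewrite !mulf_eq0 !negb_or => /and3P[_ /bG[h1 h2] _].
  by nia.
under eq_bigr => n _ do rewrite fE mulr_sumr.
rewrite exchange_big; apply: eq_bigr => i _; rewrite mulr_sumr.
by apply: eq_bigr => n _; rewrite rmorphM exprMn; ring.
Qed.

Definition moment_poly M j G : {poly F} := trunc M (moment j G).

Lemma moment_poly_mul_theta M (r c : int) j G : 0 <= r -> 0 <= c -> bounded c G ->
  'X^M %| moment_poly M j (mul_theta r G) -
    \sum_(0 <= i < j.+1) ('C(j, i)%:R * r%:~R ^+ i) *: (theta_moment F M i * moment_poly M (j - i) G).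
Proof.
move=> r0 c0 bG; apply/dvdXnP => e eM.
rewrite coefB coef_poly eM (@moment_mul_theta r c _ _ _ M) //.
apply/eqP; rewrite subr_eq0 big_mkord coef_sum; apply/eqP.
apply: eq_bigr => i _; rewrite coefZ coef_lattice_poly_trunc // => x.
exact: moment_neg bG.
Qed.

(** The series vanishes to order p at x = 1 and its derivative of order p+1 vanishes
    as well.  The third condition fixes the ratio of the derivatives of order p+2 and p:
    if theta is A t + B t^3 + ... in the variable t = log x, a product of p factors
    theta(r_i t) is (prod r_i) A^p t^p (1 + S (B/A) t^2 + ...) with S the sum of the r_i^2. *)
Definition vanishing M (p S : nat) G :=
  [/\ forall j, (j < p)%N -> 'X^M %| moment_poly M j G,
      'X^M %| moment_poly M p.+1 G,
      'X^M %| 6%:R *: (theta_moment F M 1 * moment_poly M p.+2 G)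
              - (S * p.+1 * p.+2)%:R *: (theta_moment F M 3 * moment_poly M p G)
    & (moment_poly M p G)`_0 != 0].

Lemma theta_moment1_coef0 M : (0 < M)%N -> (theta_moment F M 1)`_0 = - 2%:R.
Proof.
move=> M0; rewrite coef_lattice_poly.
pose f n : F := (-1) ^ n * (2 * n - 1)%:~R ^+ 1 * (0 == tri n)%:R.
have f0 K n : (0 < K)%N -> (K < absz n)%N -> f n = 0.
  move=> K0 hn; rewrite /f; case: eqP; rewrite ?mulr0 // => he.
  by have := tri_ge n; lia.
rewrite -(@zsumE _ M f) => [|n]; last exact: f0.
rewrite (@zsumE _ 1%N) => [|n]; last exact: f0.
rewrite /zbox /= !big_cons big_nil /f.
have -> : tri (0%:Z - 1%:Z) = 1%N by [].
have -> : tri (1%:Z - 1%:Z) = 0%N by [].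
have -> : tri (2%:Z - 1%:Z) = 0%N by [].
rewrite mulr0 !mulr1 subrr expr0z; have -> : 2%:Z - 1%:Z = 1 by [].
by rewrite expr1z; ring.
Qed.

Lemma bin3E p : ('C(p.+3, 3) * 6 = p.+1 * p.+2 * p.+3)%N.
Proof. by have := bin_ffact p.+3 3; rewrite !ffactnS ffactn0 /= => ->; lia. Qed.

(** Only the odd derivatives of theta contribute to the Leibniz rule, and those of G of
    order less than p drop out, so at most two terms survive. *)
Lemma vanishing_mul_theta M (r : nat) (c : int) p S G : (0 < M)%N -> (0 < r)%N -> 0 <= c ->
  bounded c G -> vanishing M p S G -> vanishing M p.+1 (S + r ^ 2) (mul_theta r%:Z G).
Proof.
move=> M0 r0 c0 bG [lowG G1 G2 G0].
have t0 := @theta_moment_even F M 0 isT; have t2 := @theta_moment_even F M 2 isT.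
pose term j i := ('C(j, i)%:R * (r%:Z)%:~R ^+ i) *: (theta_moment F M i * moment_poly M (j - i) G).
have rel j : 'X^M %| moment_poly M j (mul_theta r G) - \sum_(0 <= i < j.+1) term j i.
  by apply: (@moment_poly_mul_theta _ _ c).
have low j i : (j - i < p)%N -> 'X^M %| term j i.
  by move=> jp; rewrite /term -mul_polyC dvdp_mull // dvdp_mull // lowG.
have ev j i : 'X^M %| theta_moment F M i -> 'X^M %| term j i.
  by move=> jp; rewrite /term -mul_polyC dvdp_mull // dvdp_mulr.
have lowsum j a : (j < p + a)%N -> 'X^M %| \sum_(a <= i < j.+1) term j i.
  move=> h; rewrite big_nat_cond; apply: dvdp_sum => i /andP[hi _].
  by apply: low; lia.
have sub j A : 'X^M %| \sum_(0 <= i < j.+1) term j i - A ->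
    'X^M %| moment_poly M j (mul_theta r G) - A.
  by move=> h; rewrite -(subrKA (\sum_(0 <= i < j.+1) term j i)) dvdp_add.
have m0 j : (j < p.+1)%N -> 'X^M %| moment_poly M j (mul_theta r G).
  move=> jp; rewrite -[X in _ %| X]subr0; apply: sub; rewrite subr0.
  by rewrite big_ltn // dvdp_add ?ev ?lowsum //; lia.
have m1 : 'X^M %| moment_poly M p.+1 (mul_theta r G) -
    (p.+1 * r)%:R *: (theta_moment F M 1 * moment_poly M p G).
  apply: sub; rewrite big_ltn // big_ltn //.
  have -> : term p.+1 1%N = (p.+1 * r)%:R *: (theta_moment F M 1 * moment_poly M p G).
    by rewrite /term bin1 expr1 subn1 natrM.
  by rewrite addrCA addrAC subrr add0r dvdp_add ?ev ?lowsum //; lia.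
have m2 : 'X^M %| moment_poly M p.+2 (mul_theta r G).
  rewrite -[X in _ %| X]subr0; apply: sub; rewrite subr0.
  rewrite big_ltn // big_ltn // big_ltn //.
  apply: dvdp_add; first exact: ev.
  apply: dvdp_add; first by rewrite /term -mul_polyC dvdp_mull // dvdp_mull // subn1.
  by apply: dvdp_add; [exact: ev | apply: lowsum; lia].
have m3 : 'X^M %| moment_poly M p.+3 (mul_theta r G) -
   ((p.+3 * r)%:R *: (theta_moment F M 1 * moment_poly M p.+2 G) +
   ('C(p.+3, 3) * r ^ 3)%:R *: (theta_moment F M 3 * moment_poly M p G)).
  apply: sub; rewrite big_ltn // big_ltn // big_ltn // big_ltn //.
  have -> : term p.+3 1%N = (p.+3 * r)%:R *: (theta_moment F M 1 * moment_poly M p.+2 G).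
    by rewrite /term bin1 expr1 subn1 natrM.
  have -> : term p.+3 3%N = ('C(p.+3, 3) * r ^ 3)%:R *: (theta_moment F M 3 * moment_poly M p G).
    by rewrite /term natrM natrX -[(p.+3 - 3)%N]/(p - 0)%N subn0.
  set x := _ *: (theta_moment F M 1 * _); set y := _ *: (theta_moment F M 3 * _).
  set z := \sum_(4 <= i < _) _; set u := term _ 0%N; set v := term _ 2.
  have -> : u + (x + (v + (y + z))) - (x + y) = u + v + z by ring.
  by rewrite !dvdp_add ?ev // lowsum //; lia.
split=> //; last first.
  move/dvdXnP: m1 => /(_ 0%N M0)/eqP; rewrite coefB subr_eq0 => /eqP ->.
  rewrite coefZ coef0M theta_moment1_coef0 // !mulf_neq0 ?pnatr_eq0 ?oppr_eq0 ?pnatr_eq0 //.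
  by rewrite -lt0n muln_gt0 r0.
have [e1 E1] := dvdpP _ _ m1; have [e2 E2] := dvdpP _ _ G2.
have [e3 E3] := dvdpP _ _ m3.
move: E1 E2 E3; rewrite -!mul_polyC.
move: (moment_poly M p.+3 _) (moment_poly M p.+1 (mul_theta _ _))
  (moment_poly M p.+2 _) (moment_poly M p _) => A B a b.
move/eqP; rewrite subr_eq => /eqP -> E2 /eqP; rewrite subr_eq => /eqP ->.
apply/dvdpP; exists (6%:R * theta_moment F M 1 * e3 - ((S + r ^ 2) * p.+2 * p.+3)%:R * theta_moment F M 3 * e1
   + (p.+3 * r)%:R * theta_moment F M 1 * e2).
rewrite !polyC_natr in E2 *.
have b3 : ('C(p.+3, 3))%:R * 6%:R = p.+1%:R * p.+2%:R * p.+3%:R :> {poly F}.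
  by rewrite -!natrM bin3E.
rewrite !mulrDl [_ * e2 * _](_ : _ = (p.+3 * r)%:R * theta_moment F M 1 * (e2 * 'X^M)); last by ring.
rewrite -E2; move: b3; set C3 := 'C(p.+3, 3) => b3.
apply/eqP; rewrite -subr_eq0; apply/eqP.
transitivity ((C3%:R * 6%:R - p.+1%:R * p.+2%:R * p.+3%:R) *
  (theta_moment F M 1 * r%:R ^+ 3 * theta_moment F M 3 * b)); first ring.
by rewrite b3 subrr mul0r.
Qed.
End Moments.

(** * Even theta functions of degree 2k+1 *)
Definition node (k i : nat) (n : int) : int := (2 * i + 1)%N%:Z + n * (4 * k + 2)%N%:Z.

Definition node_exp (k i : nat) (n : int) : nat :=
  absz (((2 * k + 1)%N%:Z * n ^+ 2 + (2 * i + 1)%N%:Z * n) %/ 2)%Z.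

Lemma node_exp_eq k i n : (i < k)%N ->
  2 * (node_exp k i n)%:Z = (2 * k + 1)%N%:Z * n ^+ 2 + (2 * i + 1)%N%:Z * n.
Proof.
move=> ik; set x := (_ + _).
have h : 0 <= x.
  have -> : x = (2 * i + 1)%N%:Z * (n ^+ 2 + n) + (2 * (k - i))%N%:Z * n ^+ 2.
    by rewrite /x; nia.
  have h1 : 0 <= n ^+ 2 + n by nia.
  have h2 : 0 <= n ^+ 2 by nia.
  by apply: addr_ge0; apply: mulr_ge0.
have /dvdzP[y hy] : (2 %| x)%Z.
  have -> : x = n * (n - 1) + 2 * (k%:Z * n ^+ 2 + (i + 1)%N%:Z * n).
    by rewrite /x; lia.
  by rewrite rpredD ?even_mulz_pred ?dvdz_mulr.
by rewrite /node_exp -/x gez0_abs ?divz_ge0 // hy mulzK // mulrC.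
Qed.

Lemma node_exp_ge k i n : (i < k)%N -> (absz n <= node_exp k i n)%N.
Proof.
move=> ik; have := @node_exp_eq k i n ik.
have : n ^+ 2 >= (absz n)%:Z by nia.
nia.
Qed.

Section Decomposition.
Variable F : numFieldType.
Implicit Type G : int -> int -> F.

(** n shifts by d multiply by (-1)^n q^((l n + d n^2)/2) in total. *)
Lemma quasi_periodic_iter_nat d G (n : nat) e l s E : quasi_periodic d (-1) G ->
  2 * s = l + d -> 2 * E = l * n%:Z + d * n%:Z ^+ 2 ->
  G (e + E) (l + 2 * d * n%:Z) = (-1) ^ n%:Z * G e l.
Proof.
move=> qG hs; elim: n E => [|n IH] E hE.
  have -> : E = 0 by lia.
  by rewrite mulr0 !addr0 expr0z mul1r.
pose s' := s + d * n%:Z.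
have -> : e + E = (e + (E - s')) + s' by ring.
have -> : l + 2 * d * n.+1%:Z = (l + 2 * d * n%:Z) + 2 * d by lia.
rewrite qG; last by rewrite /s'; lia.
rewrite IH; last by rewrite /s'; lia.
by rewrite -[n.+1]addn1 PoszD sgnD expr1z; ring.
Qed.

Lemma quasi_periodic_iter d G (n : int) e l s E : quasi_periodic d (-1) G ->
  2 * s = l + d -> 2 * E = l * n + d * n ^+ 2 ->
  G (e + E) (l + 2 * d * n) = (-1) ^ n * G e l.
Proof.
move=> qG hs hE; case: (leP 0 n) => n0.
  by rewrite -(gez0_abs n0) in hE *; exact: quasi_periodic_iter_nat hs hE.
have nE : n = - (absz n)%:Z by lia.
have := @quasi_periodic_iter_nat d G (absz n) (e + E) (l + 2 * d * n) (s + d * n) (- E) qG.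
rewrite addrK (_ : l + 2 * d * n + 2 * d * (absz n)%:Z = l); last by rewrite nE; lia.
move=> ->; last by rewrite nE in hE *; lia.
  have hn : (-1) ^ n = (-1) ^ (absz n)%:Z :> F by rewrite {1}nE sgnN.
  by rewrite hn mulrA sgnSq mul1r.
lia.
Qed.

(** The exponents d and -d are exchanged both by the shift, with sign -1, and by
    x -> 1/x, with sign 1. *)
Lemma antiperiodic_class d G : quasi_periodic d (-1) G -> parity 1 G ->
  forall e n, G e (d + 2 * d * n) = 0.
Proof.
move=> qG pG e n.
have h e' : G e' d = 0.
  have := qG e' (- d) 0; rewrite addr0 addNr => /(_ erefl).
  have -> : - d + 2 * d = d by ring.
  rewrite pG mul1r mulN1r => /eqP; rewrite -addr_eq0 -mulr2n mulrn_eq0 /=.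
  by move/eqP.
have /dvdzP[x hx] := even_mulz_pred (n + 1).
pose E := d * x.
have -> : e = (e - E) + E by ring.
have hE : 2 * E = d * n + d * n ^+ 2 by rewrite /E; lia.
by rewrite (quasi_periodic_iter _ qG _ hE (s := d)) ?h ?mulr0 //; lia.
Qed.

(** The residues 2i+1 and -(2i+1), for i < k, exhaust the odd residues modulo 4k+2
    other than 2k+1, each exactly once. *)
Lemma odd_residue (k : nat) (l : int) (c : F) : (2 %| l - 1)%Z ->
  ~~ ((4 * k + 2)%N%:Z %| l - (2 * k + 1)%N%:Z)%Z ->
  c = \sum_(i < k) ((if ((4 * k + 2)%N%:Z %| l - (2 * i + 1)%N%:Z)%Z then c else 0) +
                     (if ((4 * k + 2)%N%:Z %| l - - (2 * i + 1)%N%:Z)%Z then c else 0)).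
Proof.
set b := (4 * k + 2)%N%:Z => l1 ln.
have b0 : b != 0 by rewrite /b; lia.
pose rho := (l %% b)%Z; have lE : l = (l %/ b)%Z * b + rho := divz_eq l b.
have r0 : 0 <= rho := modz_ge0 l b0.
have rb : rho < b by apply: ltz_pmod; rewrite /b; lia.
have dvdE x : (b %| l - x)%Z = (b %| rho - x)%Z.
  by rewrite {1}lE -addrA rpredDl ?dvdz_mull.
have smallE x y : - b < x - b * y < b -> (b %| x)%Z = (x == b * y).
  move=> hx; apply/idP/eqP => [/dvdzP[z hz]|->]; last exact: dvdz_mulr.
  have bpos : 0 < b by rewrite /b; lia.
  move/andP: hx; rewrite hz => -[h1 h2].
  have : z = y by nia.
  by move=> ->; rewrite mulrC.
rewrite dvdE (smallE _ 0) in ln; last by rewrite /b in rb *; lia.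
have rodd : exists m : nat, rho = (2 * m + 1)%N%:Z.
  exists (absz (rho %/ 2)%Z); move/dvdzP: l1 => [z hz].
  by move: lE; rewrite /b; move: (l %/ _)%Z => y; lia.
have [m rE] := rodd.
have E1 (i : 'I_k) : (b %| l - (2 * i + 1)%N%:Z)%Z = (i == m :> nat).
  rewrite dvdE (smallE _ 0); last by have := ltn_ord i; rewrite /b in rb *; lia.
  by rewrite rE; lia.
have E2 (i : 'I_k) : (b %| l - - (2 * i + 1)%N%:Z)%Z = (i == 2 * k - m :> nat)%N.
  rewrite dvdE (smallE _ 1); last by have := ltn_ord i; rewrite /b in rb *; lia.
  by rewrite rE; have := ltn_ord i; rewrite /b in rb *; lia.
under eq_bigr => i _ do rewrite E1 E2.
case: (ltnP m k) => mk.
  rewrite (bigD1 (Ordinal mk)) //= eqxx big1 => [|i].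
    by rewrite ifF ?addr0 //; lia.
  rewrite -val_eqE /= => /negbTE ->; rewrite ifF ?addr0 //.
  by have := ltn_ord i; lia.
(* Here the residue exceeds 2k+1; it is the opposite of 2(2k-m)+1. *)
have mk2 : (2 * k - m < k)%N by rewrite rE in ln; lia.
rewrite (bigD1 (Ordinal mk2)) //= eqxx big1 => [|i].
  by rewrite ifF ?add0r ?addr0 //; lia.
rewrite -val_eqE /= => /negbTE ->; rewrite ifF ?addr0 //.
by have := ltn_ord i; lia.
Qed.

(** By quasi-periodicity and evenness the coefficients of G at x^(l/2) with l = 2i+1,
    i < k, determine all the others. *)
Lemma moment_decomposition (k : nat) (c : int) G (e : int) (N j : nat) :
  parity 1 G -> quasi_periodic (2 * k + 1)%N%:Z (-1) G -> odd_supported 1 G ->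
  0 <= c -> bounded c G -> e < N%:Z -> ~~ odd j ->
  moment j G e = 2%:R * \sum_(i < k) \sum_(n <- zbox N)
     ((-1) ^ n * (node k i n)%:~R ^+ j) * G (e - (node_exp k i n)%:Z) (2 * i + 1)%N%:Z.
Proof.
move=> pG qG oG c0 bG eN jo.
pose h l : F := G e l * l%:~R ^+ j.
have hN l : h (- l) = h l.
  by rewrite /h pG mul1r mulrNz exprNn -signr_odd (negbTE jo) expr0 mul1r.
set b := (4 * k + 2)%N%:Z.
have b0 : b != 0 by rewrite /b; lia.
pose B : nat := absz (c * (e + 1)).
have hB l : (B < absz l)%N -> h l = 0.
  by move=> hl; apply: eq0_contra; rewrite mulf_eq0 negb_or => /andP[/bG[]]; nia.
pose u rho l : F := if (b %| l - rho)%Z then h l else 0.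
have uB rho l : (B < absz l)%N -> u rho l = 0.
  by rewrite /u => /hB ->; rewrite if_same.
pose ro (i : nat) := (2 * i + 1)%N%:Z.
have -> : moment j G e = zsum (fun l => \sum_(i < k) (u (ro i) l + u (- ro i) l)).
  apply: eq_zsum => l; rewrite -/(h l).
  have [hl|hl] := eqVneq (h l) 0.
    by rewrite big1 // => i _; rewrite /u hl !if_same addr0.
  apply: odd_residue.
    by move: hl; rewrite mulf_eq0 negb_or => /andP[/oG].
  apply: contra hl => /dvdzP[y hy]; rewrite /h.
  have -> : l = (2 * k + 1)%N%:Z + 2 * (2 * k + 1)%N%:Z * y by lia.
  by rewrite (antiperiodic_class qG pG) mul0r.
rewrite (@zsum_sum _ _ _ B); last by move=> i l hl; rewrite !uB ?addr0.
rewrite mulr_sumr; apply: eq_bigr => i _.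
have uE rho : zsum (u rho) = zsum (fun n => h (rho + b * n)) by rewrite zsum_residue.
have ik := ltn_ord i.
have main : zsum (u (ro i)) = \sum_(n <- zbox N)
     ((-1) ^ n * (node k i n)%:~R ^+ j) * G (e - (node_exp k i n)%:Z) (2 * i + 1)%N%:Z.
  rewrite uE -(@zsumE _ N (fun n => (-1) ^ n * (node k i n)%:~R ^+ j *
    G (e - (node_exp k i n)%:Z) (2 * i + 1)%N%:Z)); last first.
    move=> n hn; apply: eq0_contra; rewrite mulf_eq0 negb_or => /andP[_ /bG[]].
    by have := @node_exp_ge k i n ik; lia.
  apply: eq_zsum => n; rewrite /h.
  have -> : ro i + b * n = node k i n by rewrite /node /ro /b; ring.
  rewrite mulrAC; congr (_ * _).
  have -> : node k i n = (2 * i + 1)%N%:Z + 2 * (2 * k + 1)%N%:Z * n by rewrite /node; lia.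
  rewrite -(@quasi_periodic_iter _ G n _ _ (i + k + 1)%N%:Z (node_exp k i n)%:Z qG); last 2 first.
  - by lia.
  - by rewrite node_exp_eq //; ring.
  by rewrite subrK.
have symm : zsum (u (- ro i)) = zsum (u (ro i)).
  rewrite !uE (zsum_reflect 0); apply: eq_zsum => n.
  by rewrite -hN; congr h; ring.
rewrite (_ : zsum _ = zsum (u (ro i)) + zsum (u (- ro i))).
  by rewrite symm main; ring.
pose v (s : bool) l := if s then u (ro i) l else u (- ro i) l.
have -> : zsum (u (ro i)) + zsum (u (- ro i)) = \sum_(s <- [:: true; false]) zsum (v s).
  by rewrite !big_cons big_nil addr0.
rewrite -(@zsum_sum _ _ _ B); first by apply: eq_zsum => l; rewrite !big_cons big_nil addr0.
by move=> [] l hl; rewrite /v uB.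
Qed.

(** The series f_(i+1,j), truncated to |n| <= K. *)
Definition theta_null K k i j : {poly F} :=
  lattice_poly (zbox K) (fun n => (-1) ^ n * (node k i n)%:~R ^+ j) (node_exp k i).

(** An even theta function of degree 2k+1 is a combination of the k theta functions with
    derivatives theta_null, with coefficients that do not depend on the order j of the
    derivative. *)
Lemma moment_poly_span M (k : nat) (c : int) G (j : nat) :
  parity 1 G -> quasi_periodic (2 * k + 1)%N%:Z (-1) G -> odd_supported 1 G ->
  0 <= c -> bounded c G -> ~~ odd j ->
  'X^M %| moment_poly M j G - 2%:R *: \sum_(i < k)
     theta_null M k i j * trunc M (fun e => G e (2 * i + 1)%N%:Z).
Proof.
move=> pG qG oG c0 bG jo; apply/dvdXnP => e eM.
rewrite coefB coef_poly eM coefZ coef_sum.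
rewrite (@moment_decomposition k c _ _ M) //.
apply/eqP; rewrite subr_eq0; apply/eqP; congr (_ * _).
apply: eq_bigr => i _; rewrite coef_lattice_poly_trunc // => x x0.
by apply: eq0_contra => /bG[]; lia.
Qed.

End Decomposition.

(** * The product theta(x^2) theta(x)^(2k-3) *)
Section ThetaProduct.
Variable F : numFieldType.
Implicit Type G : int -> int -> F.

(** The highest power of x in the constant term in q. *)
Definition top_degree (p : int) G := (forall l, p < l -> G 0 l = 0) /\ G 0 p != 0.

Lemma mul_theta_constant_term r c G l : bounded c G ->
  mul_theta r G 0 l = G 0 (l + r) - G 0 (l - r).
Proof.
move=> bG; rewrite /mul_theta (@zsumE _ 1%N) => [|n hn]; last first.
  apply: eq0_contra; rewrite mulf_eq0 negb_or => /andP[_ /bG[]].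
  by have := tri_ge n; have := tri_eq n; nia.
rewrite /zbox /= !big_cons big_nil.
have -> : tri (0%:Z - 1%:Z) = 1%N by [].
have -> : tri (1%:Z - 1%:Z) = 0%N by [].
have -> : tri (2%:Z - 1%:Z) = 0%N by [].
have -> : 2%:Z - 1%:Z = 1 by [].
rewrite (_ : G (0 - 1%:Z) _ = 0); last by apply: eq0_contra => /bG[].
rewrite !subrr expr0z expr1z mulr0 mul1r mulN1r add0r addr0.
by congr (G _ _ - G _ _); ring.
Qed.

Lemma top_degree_mul_theta (r p c : int) G : 0 < r -> bounded c G -> top_degree p G ->
  top_degree (p + r) (mul_theta r G).
Proof.
move=> r0 bG [G0 Gp]; split=> [l hl|]; rewrite (mul_theta_constant_term _ _ bG).
  by rewrite !G0 ?subrr //; lia.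
by rewrite addrK G0 ?sub0r ?oppr_eq0 //; lia.
Qed.

(** What the multiplication by theta(x^r) preserves or updates, for a product of m
    factors theta(x^r_i); p is the sum of the r_i and d the sum of the r_i^2. *)
Record theta_product_spec M (m : nat) (p d : nat) (eps : F) G : Prop := ThetaProductSpec {
  tp_bounded : exists2 c : int, 0 <= c & bounded c G;
  tp_parity : parity ((-1) ^+ m) G;
  tp_quasi : quasi_periodic d%:Z eps G;
  tp_odd : odd_supported p%:Z G;
  tp_top : top_degree p%:Z G;
  tp_vanish : vanishing M m d G }.

Lemma theta_product_unit M : (0 < M)%N -> theta_product_spec M 0 0 0 1 (unit_series F).
Proof.
move=> M0; split.
- by exists 0 => // e l /unit_seriesP[-> ->].
- by move=> e l; rewrite /unit_series oppr_eq0 expr0 mul1r.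
- move=> e l s hs; rewrite /unit_series mul1r mulr0 addr0.
  by have [l0|] := eqVneq l 0; rewrite ?andbF //; congr (_ && _)%:R; lia.
- by move=> e l /unit_seriesP[_ ->]; rewrite subr0.
- split=> [l hl|]; first by apply: eq0_contra => /unit_seriesP[]; lia.
  by rewrite /unit_series !eqxx oner_eq0.
have m0 j : (0 < j)%N -> moment_poly M j (unit_series F) = 0.
  move=> j0; apply/polyP => e; rewrite coef0 coef_poly; case: ifP => // _.
  apply: zsum0 => l; rewrite /unit_series; have [->|] := eqVneq l 0.
    by rewrite expr0n eqn0Ngt j0 mulr0.
  by rewrite andbF mul0r.
split=> //; first by rewrite m0 ?dvdp0.
  by rewrite m0 // mulr0 scaler0 !mul0n scaler_nat mulr0n subr0 dvdp0.
rewrite coef_poly M0 /moment (@zsumE _ 0%N) => [|n hn].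
  by rewrite /zbox /= big_cons big_nil /unit_series subrr eqxx expr0 mulr1 addr0 oner_eq0.
by rewrite /unit_series; case: (n =P 0) => [|_]; rewrite ?andbF ?mul0r //; lia.
Qed.

Lemma theta_product_step M (r : nat) m p d eps G : (0 < M)%N -> (0 < r)%N ->
  theta_product_spec M m p d eps G ->
  theta_product_spec M m.+1 (p + r) (d + r ^ 2) ((-1) ^ r%:Z * eps) (mul_theta r%:Z G).
Proof.
move=> M0 r0 [[c c0 bG] pG qG oG tG vG]; split.
- by exists (c + 2 * r%:Z); [lia | exact: bounded_mul_theta].
- by rewrite exprS mulN1r; exact: parity_mul_theta.
- by have -> : (d + r ^ 2)%N%:Z = d%:Z + r%:Z ^+ 2 by []; exact: quasi_periodic_mul_theta.
- by rewrite PoszD; exact: odd_supported_mul_theta.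
- by rewrite PoszD; apply: top_degree_mul_theta bG tG; lia.
exact: vanishing_mul_theta bG vG.
Qed.

(** One factor theta(x^2) and 2k-3 factors theta(x): the degree is 4 + (2k-3) = 2k+1, the
    order of vanishing 2k-2 and the multiplier (-1)^(2k-3) = -1. *)
Lemma theta_product_exists M k : (0 < M)%N -> (2 <= k)%N ->
  exists2 G, theta_product_spec M (2 * k - 2) (2 * k - 1) (2 * k + 1) (-1) G & odd_supported 1 G.
Proof.
move=> M0 k2.
have pow m : exists G, theta_product_spec M m m m ((-1) ^+ m) G.
  elim: m => [|m [G /(theta_product_step M0 (isT : (0 < 1)%N))]].
    by exists (unit_series F); exact: theta_product_unit.
  by rewrite !addn1 => h; exists (mul_theta 1%:Z G); rewrite exprS.
have [G /(theta_product_step M0 (isT : (0 < 2)%N))] := pow (2 * k - 3)%N.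
have -> : (2 * k - 3).+1 = (2 * k - 2)%N by lia.
have -> : (2 * k - 3 + 2 = 2 * k - 1)%N by lia.
have -> : (2 * k - 3 + 2 ^ 2 = 2 * k + 1)%N by lia.
rewrite (_ : _ ^ _ * _ = -1); last first.
  rewrite -signr_odd; have -> : odd (2 * k - 3) by lia.
  by rewrite expr1 -exprnP sqrrN expr1n mul1r.
move=> h; exists (mul_theta 2%:Z G) => // e l /(tp_odd h); lia.
Qed.
End ThetaProduct.

(** * Vandermonde determinants and the Wronskian relation *)
Section Determinants.
Variable F : numFieldType.

(** The exponents 0, 1, ..., k-2, k, which skip k-1. *)
Definition skip (k j : nat) : nat := if j.+1 == k then k else j.

Definition power_mx (R : nzRingType) k (ex : nat -> nat) (f : 'I_k -> nat -> R) : 'M[R]_k :=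
  \matrix_(j < k, i < k) f i (ex j).

(** Each x_i is a root of prod (X - x_l), so its k-th power is a combination of the lower
    ones in which the power k-1 has coefficient sum x_l.  In matrix form the skipped
    Vandermonde matrix is a triangular matrix times the Vandermonde matrix. *)
Lemma det_skip_Vandermonde k (x : 'I_k.+1 -> F) :
  \det (power_mx (skip k.+1) (fun i j => x i ^+ j)) =
  (\sum_i x i) * \det (power_mx id (fun i j => x i ^+ j)).
Proof.
pose p := \prod_(i < k.+1) ('X - (x i)%:P).
(* Identity, except for the last row: minus the lower coefficients of p. *)
pose C : 'M[F]_k.+1 := \matrix_(j, m) if j.+1 == k.+1 then - p`_m else (j == m)%:R.
have sp : size p = k.+2 by rewrite size_prod_XsubC /index_enum -enumT size_enum_ord.
have pk : p`_k.+1 = 1.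
  by have := monic_prod_XsubC (index_enum _) xpredT x; rewrite monicE lead_coefE sp => /eqP.
have pk1 : - p`_k = \sum_i x i.
  pose s := [seq x i | i <- index_enum 'I_k.+1].
  have ss : size s = k.+1 by rewrite size_map /index_enum -enumT size_enum_ord.
  have := @coefPn_prod_XsubC _ s; rewrite ss => /(_ isT).
  by rewrite !big_map /= => ->; rewrite opprK.
have -> : power_mx (skip k.+1) (fun i j => x i ^+ j) =
    C *m power_mx id (fun i j => x i ^+ j).
  apply/matrixP => j i; rewrite !mxE /skip; case: ifP => jk; last first.
    rewrite (bigD1 j) //= !mxE jk eqxx mul1r big1 ?addr0 // => m mj.
    by rewrite !mxE jk eq_sym (negbTE mj) mul0r.
  have : p.[x i] = 0 by rewrite horner_prod (bigD1 i) //= hornerXsubC subrr mul0r.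
  rewrite horner_coef sp big_ord_recr /= pk mul1r => /eqP; rewrite addrC addr_eq0 => /eqP ->.
  by rewrite -sumrN; apply: eq_bigr => m _; rewrite !mxE jk mulNr.
rewrite det_mulmx det_trig; last first.
  apply/is_trig_mxP => j m jm; rewrite mxE ifF; last by have := ltn_ord m; lia.
  by case: eqP jm => [->|//]; rewrite ltnn.
rewrite big_ord_recr /= mxE /= !eqxx pk1 big1 ?mul1r // => j _.
by rewrite mxE ifF ?eqxx //= eqSS; have := ltn_ord j; lia.
Qed.

Lemma det_annihilated M k (N : 'M[{poly F}]_k) (c : 'cV[{poly F}]_k) i0 :
  (forall j, 'X^M %| (N *m c) j 0) -> (c i0 0)`_0 != 0 -> 'X^M %| \det N.
Proof.
move=> h c0; apply: (@dvdXn_cancel _ _ (c i0 0)) => //.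
have -> : c i0 0 * \det N = (\adj N *m (N *m c)) i0 0.
  by rewrite mulmxA mul_adj_mx mul_scalar_mx mxE mulrC.
by rewrite mxE; apply: dvdp_sum => j _; rewrite dvdp_mull.
Qed.

(** The coefficients c_i of b in the basis annihilate the rows of exponents
    0, 2, ..., 2k-4 and u (row 2k) - v (row 2k-2), so the determinant formed with these
    rows vanishes.  Cancelling c_i needs a constant term: that of c_k is the
    leading coefficient of b at q = 0. *)
Lemma wronskian_relation M k : (0 < M)%N -> (2 <= k)%N ->
  'X^M %| 6%:R *: (theta_moment F M 1 *
      \det (power_mx (skip k) (fun (i : 'I_k) j => theta_null F M k i (2 * j))))
   - ((2 * k + 1) * (2 * k - 1) * (2 * k))%:R *:
       (theta_moment F M 3 * \det (power_mx id (fun (i : 'I_k) j => theta_null F M k i (2 * j)))).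
Proof.
move=> M0 k2; have [G [[c c0 bG] pG qG _ [_ Gtop] [low v1 v2 u0]] oG] := @theta_product_exists F M k M0 k2.
have k0 : (k.-1 < k)%N by lia.
pose last := Ordinal k0.
set A := power_mx id _; set B := power_mx (skip k) _.
have p3 : (2 * k - 2).+2 = (2 * k)%N by lia.
rewrite p3 in v2.
have k22 : (2 * k - 2)%N = (2 * k.-1)%N by lia.
set u := moment_poly M (2 * k - 2) G in v2 u0; set v := moment_poly M (2 * k) G in v2.
pose N : 'M[{poly F}]_k := \matrix_(j, i) if j == last then u * B j i - v * A j i else A j i.
pose cv : 'cV[{poly F}]_k := \col_i trunc M (fun e => G e (2 * i + 1)%N%:Z).
have pG1 : parity 1 G by rewrite -[1](expr0 (-1)) -[0%N](_ : odd (2 * k - 2) = 0%N :> nat) ?signr_odd //; lia.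
have span j : ~~ odd j -> 'X^M %| moment_poly M j G - 2%:R *: \sum_(i < k) theta_null F M k i j * cv i 0.
  move=> jo; under eq_bigr => i _ do rewrite mxE.
  exact: moment_poly_span bG jo.
have spanE (D : 'M[{poly F}]_k) j e : ~~ odd e -> (forall i, D j i = theta_null F M k i e) ->
    'X^M %| moment_poly M e G - 2%:R *: (D *m cv) j 0.
  move=> eo De; rewrite mxE; under eq_bigr => i _ do rewrite De; exact: span.
have two0 : (2%:R : F) != 0 by rewrite pnatr_eq0.
have detN : 'X^M %| \det N.
  apply: (@det_annihilated _ _ _ cv last); last first.
    rewrite mxE coef_poly M0 /=.
    by have -> : (2 * k.-1 + 1)%N = (2 * k - 1)%N by lia.
  move=> j; rewrite -(dvdpZr _ _ two0).
  case: (eqVneq j last) => [-> | jl]; last first.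
    have jk : (j.+1 < k)%N.
      by have := ltn_ord j; move: jl; rewrite -val_eqE /=; lia.
      (* The derivatives of b of order less than 2k-2 vanish. *)
  rewrite -(dvdp_subr _ (low (2 * j)%N _)); last by lia.
    apply: spanE; first by lia.
    by move=> i; rewrite !mxE (negbTE jl).
  have hB := @spanE B last (2 * k)%N _ _; have hA := @spanE A last (2 * k - 2)%N _ _.
  have {hB} /dvdpP[q1 /eqP] := hB ltac:(lia) ltac:(by move=> i; rewrite mxE /skip /= prednK ?eqxx //; lia).
  rewrite -/v subr_eq => /eqP q1E.
  have {hA} /dvdpP[q2 /eqP] := hA ltac:(lia) ltac:(by move=> i; rewrite mxE k22).
  rewrite -/u subr_eq => /eqP q2E.
  have -> : (N *m cv) last 0 = u * (B *m cv) last 0 - v * (A *m cv) last 0.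
    rewrite !mxE !mulr_sumr -sumrB; apply: eq_bigr => i _.
    by rewrite !mxE eqxx; ring.
  apply/dvdpP; exists (v * q2 - u * q1).
  move: q1E q2E; rewrite -!mul_polyC polyC_natr.
  move: (B *m cv) (A *m cv) => Y Z q1E q2E.
  have -> : (v * q2 - u * q1) * 'X^M = v * (q2 * 'X^M) - u * (q1 * 'X^M) by ring.
  have -> : q1 * 'X^M = v - 2%:R * Y last 0 by rewrite q1E; ring.
  have -> : q2 * 'X^M = u - 2%:R * Z last 0 by rewrite q2E; ring.
  by ring.
have detE : \det N = u * \det B - v * \det A.
  rewrite -[- (v * _)]mulNr; apply: (@determinant_multilinear _ _ N B A last).
  - by apply/rowP => i; rewrite !mxE eqxx; ring.
  - apply/matrixP => j i; rewrite !mxE /skip ifF; last first.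
      have : lift last j != last by rewrite eq_sym neq_lift.
      by have := ltn_ord (lift last j); rewrite -val_eqE /=; lia.
    by rewrite eq_sym (negbTE (neq_lift _ _)).
  - by apply/matrixP => j i; rewrite !mxE eq_sym (negbTE (neq_lift _ _)).
apply: (@dvdXn_cancel _ _ u) => //.
have [q3 q3E] := dvdpP _ _ v2; have [q4 q4E] := dvdpP _ _ detN.
rewrite detE in q4E.
apply/dvdpP; exists (6%:R * theta_moment F M 1 * q4 + \det A * q3).
have -> : (6%:R * theta_moment F M 1 * q4 + \det A * q3) * 'X^M =
  6%:R * theta_moment F M 1 * (q4 * 'X^M) + \det A * (q3 * 'X^M) by ring.
rewrite -q3E -q4E -!mul_polyC !polyC_natr.
have -> : ((2 * k + 1) * (2 * k - 2).+1 * (2 * k))%N = ((2 * k + 1) * (2 * k - 1) * (2 * k))%N.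
  by have -> : (2 * k - 2).+1 = (2 * k - 1)%N by lia.
by ring.
Qed.
End Determinants.

(** * The Wronskian as a sum over a box *)
Section BoxExpansion.
Variable F : numFieldType.

Definition zpoint K (x : 'I_(K + K).+1) : int := x%:Z - K%:Z.

Lemma big_zbox (V : nmodType) K (f : int -> V) :
  \sum_(n <- zbox K) f n = \sum_(x < (K + K).+1) f (zpoint x).
Proof. by rewrite big_map -[iota 0 _]/(index_iota 0 (K + K).+1) big_mkord. Qed.

Definition box_sign k K (g : {ffun 'I_k -> 'I_(K + K).+1}) : F :=
  \prod_(i < k) (-1) ^ (zpoint (g i)).
Definition box_exp k K (g : {ffun 'I_k -> 'I_(K + K).+1}) : nat :=
  \sum_(i < k) node_exp k i (zpoint (g i)).
Definition box_node_sq k K (g : {ffun 'I_k -> 'I_(K + K).+1}) (i : 'I_k) : F :=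
  (node k i (zpoint (g i)))%:~R ^+ 2.

(** Multilinearity of the determinant in the k theta series. *)
Lemma det_theta_null k K ex :
  \det (power_mx ex (fun (i : 'I_k) j => theta_null F K k i (2 * j))) =
  \sum_(g : {ffun 'I_k -> 'I_(K + K).+1})
    (box_sign g * \det (power_mx ex (fun i j => box_node_sq g i ^+ j))) *: 'X^(box_exp g).
Proof.
rewrite -det_tr /determinant.
have -> : \sum_(g : {ffun 'I_k -> 'I_(K + K).+1})
    (box_sign g * \det (power_mx ex (fun i j => box_node_sq g i ^+ j))) *: 'X^(box_exp g) =
  \sum_(g : {ffun 'I_k -> 'I_(K + K).+1}) \sum_(s : 'S_k)
    ((-1) ^+ s * \prod_(i < k) ((-1) ^ zpoint (g i) * (node k i (zpoint (g i)))%:~R ^+ (2 * ex (s i)))) *: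
     'X^(box_exp g).
  apply: eq_bigr => g _; rewrite -det_tr /determinant mulr_sumr scaler_suml.
  apply: eq_bigr => s _; congr (_ *: _); rewrite big_split /= mulrCA; congr (_ * (_ * _)).
  by apply: eq_bigr => i _; rewrite !mxE -exprM.
rewrite exchange_big; apply: eq_bigr => s _.
have -> : \prod_(i < k) (power_mx ex (fun (i : 'I_k) j => theta_null F K k i (2 * j)))^T i (s i) =
   \prod_(i < k) \sum_(x < (K + K).+1) ((-1) ^ zpoint x * (node k i (zpoint x))%:~R ^+ (2 * ex (s i))) *:
      'X^(node_exp k i (zpoint x)).
  by apply: eq_bigr => i _; rewrite !mxE /theta_null /lattice_poly big_zbox.
rewrite bigA_distr_bigA mulr_sumr; apply: eq_bigr => g _ /=.
rewrite scaler_prod prodrXr -!mul_polyC mulrA polyCM; congr (_ * _ * _).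
by case: (odd_perm s); rewrite ?expr0 ?expr1 ?polyCN ?polyC1.
Qed.

Definition box_discr k K (g : {ffun 'I_k -> 'I_(K + K).+1}) : F :=
  \prod_(i < k) \prod_(j < k | (i < j)%N) (box_node_sq g j - box_node_sq g i).

Lemma det_power_mx k (x : 'I_k -> F) :
  \det (power_mx id (fun i j => x i ^+ j)) =
  \prod_(i < k) \prod_(j < k | (i < j)%N) (x j - x i).
Proof.
have := @det_Vandermonde F k (\row_i x i).
under eq_bigr => i _ do under eq_bigr => j _ do rewrite !mxE.
move=> <-; congr (\det _); apply/matrixP => j i; by rewrite !mxE.
Qed.

Definition box_poly k K : {poly F} :=
  \sum_(g : {ffun 'I_k -> 'I_(K + K).+1}) (box_sign g * box_discr g) *: 'X^(box_exp g).

Lemma det_wronskian k K :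
  \det (power_mx id (fun (i : 'I_k) j => theta_null F K k i (2 * j))) = box_poly k K.
Proof. by rewrite det_theta_null; apply: eq_bigr => g _; rewrite det_power_mx. Qed.

Lemma node_sq k i n : (i < k)%N ->
  (node k i n) ^+ 2 = (8 * (2 * k + 1))%N%:Z * (node_exp k i n)%:Z + ((2 * i + 1) ^ 2)%N%:Z.
Proof.
move=> ik; have h := node_exp_eq n ik.
have -> : (8 * (2 * k + 1))%N%:Z * (node_exp k i n)%:Z =
   (4 * (2 * k + 1))%N%:Z * (2 * (node_exp k i n)%:Z) by lia.
rewrite h /node; lia.
Qed.

Lemma sum_odd_squares k : (3 * \sum_(i < k) (2 * i + 1) ^ 2 = k * ((2 * k + 1) * (2 * k - 1)))%N.
Proof.
elim: k => [|k IH]; first by rewrite big_ord0.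
by rewrite big_ord_recr mulnDr IH /=; lia.
Qed.

(** q d/dq multiplies a term by its exponent, an affine function of the sum of the squared
    nodes, which det_skip_Vandermonde absorbs. *)
Lemma box_poly_heat k K : (0 < k)%N ->
  (8 * (2 * k + 1))%:R *: ('X * (box_poly k K)^`()) +
    (\sum_(i < k) (2 * i + 1) ^ 2)%N%:R *: box_poly k K =
  \det (power_mx (skip k) (fun (i : 'I_k) j => theta_null F K k i (2 * j))).
Proof.
move=> k0; rewrite det_theta_null /box_poly raddf_sum mulr_sumr !scaler_sumr -big_split.
apply: eq_bigr => g _ /=; rewrite X_deriv_monomial !scalerA -scalerDl; congr (_ *: _).
have -> : \det (power_mx (skip k) (fun i j => box_node_sq g i ^+ j)) =
    (\sum_i box_node_sq g i) * box_discr g.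
  case: k k0 g => // k _ g; by rewrite det_skip_Vandermonde det_power_mx.
have -> : \sum_i box_node_sq g i = (8 * (2 * k + 1))%:R * (box_exp g)%:R +
    (\sum_(i < k) (2 * i + 1) ^ 2)%N%:R :> F.
  rewrite !natr_sum mulr_sumr -big_split; apply: eq_bigr => i _ /=.
  rewrite /box_node_sq -rmorphXn /= node_sq ?ltn_ord // rmorphD rmorphM /=.
  by rewrite -!pmulrn.
by ring.
Qed.

Lemma box_poly_theta_ode k M : (0 < M)%N -> (2 <= k)%N ->
  'X^M %| 3%:R *: (theta_moment F M 1 * ('X * (box_poly k M)^`())) -
    (k * (2 * k - 1))%:R *: ('X * (theta_moment F M 1)^`() * box_poly k M).
Proof.
move=> M0 k2; have := @wronskian_relation F M k M0 k2.
rewrite det_wronskian -box_poly_heat; last by lia.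
rewrite -theta_moment_heat.
set W := box_poly k M; set t := theta_moment F M 1; set S := (\sum_(i < k) _)%N.
have c0 : ((48 * (2 * k + 1))%:R : F) != 0 by rewrite pnatr_eq0; lia.
have hS : 3%:R * S%:R = (k * ((2 * k + 1) * (2 * k - 1)))%:R :> {poly F}.
  by rewrite -natrM sum_odd_squares.
set E1 := (X in _ %| X -> _); move=> h; rewrite -(dvdpZr _ _ c0).
rewrite (_ : _ *: _ = 3%:R * E1); first by rewrite dvdp_mull.
rewrite /E1 -!mul_polyC !polyC_natr.
move: hS; rewrite !natrM; move: (2 * k - 1)%N => j hS.
apply/eqP; rewrite -subr_eq0; apply/eqP.
transitivity ((k%:R * ((2 * k + 1)%:R * j%:R) - 3%:R * S%:R) * (6%:R * t * W) : {poly F}).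
  by ring.
by rewrite hS subrr mul0r.
Qed.
End BoxExpansion.

(** * Jacobi's identity for the cube of the Euler product *)
Section Jacobi.
Variable F : numFieldType.

(** Gaussian binomial coefficients. *)
Fixpoint qbin (n m : nat) : {poly F} :=
  match n, m with
  | _, 0 => 1
  | 0, _.+1 => 0
  | n.+1, m.+1 => 'X^(m.+1) * qbin n m.+1 + qbin n m
  end.

Arguments qbin : simpl never.

Lemma qbin0 n : qbin n 0 = 1. Proof. by case: n. Qed.

Lemma qbinS n m : qbin n.+1 m.+1 = 'X^(m.+1) * qbin n m.+1 + qbin n m.
Proof. by []. Qed.

Lemma qbin_small n m : (n < m)%N -> qbin n m = 0.
Proof.
elim: n m => [|n IH] [|m] // nm.
by rewrite qbinS !IH ?mulr0 ?addr0 //; lia.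
Qed.

Lemma qbin_diag n : qbin n n = 1.
Proof. by elim: n => // n IH; rewrite qbinS qbin_small ?mulr0 ?add0r. Qed.

(** The second Pascal rule. *)
Lemma qbinS' n m : qbin n.+1 m.+1 = qbin n m.+1 + 'X^(n - m) * qbin n m.
Proof.
case: (leqP m n) => [mn|nm]; last by rewrite !qbin_small ?mulr0 ?addr0 //; lia.
elim: n m mn => [|n IH] m mn.
  by case: m mn => // _; rewrite qbinS qbin_small // mulr0 add0r subnn expr0 mul1r add0r.
move: mn; rewrite leq_eqVlt => /orP[/eqP ->|mn].
  by rewrite subnn !qbin_diag qbin_small // add0r mul1r.
case: m mn => [_|m mn].
  have p1 := IH 0%N isT; have p2 := qbinS n 0.
  rewrite qbin0 subn0 mulr1 in p1; rewrite qbin0 in p2.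
  rewrite qbinS !qbin0 subn0 mulr1 [X in X + 'X^_]p2 p1 mulrDr -exprD add1n; ring.
have p1 := IH m.+1 mn; have p2 := IH m (ltnW mn).
rewrite [LHS]qbinS [in LHS]p1 [in LHS]p2 [qbin n.+1 m.+2 in RHS]qbinS [qbin n.+1 m.+1 in RHS]qbinS subSS.
have e : 'X^(m.+2) * 'X^(n - m.+1) = 'X^(n - m) * 'X^(m.+1) :> {poly F}.
  by rewrite -!exprD; congr ('X^_); lia.
by rewrite [in LHS]mulrDr mulrA e; ring.
Qed.

Lemma qbin_sym n m : (m <= n)%N -> qbin n m = qbin n (n - m).
Proof.
elim: n m => [|n IH] [|m] mn //; first by rewrite qbin0 subn0 qbin_diag.
move: mn; rewrite ltnS leq_eqVlt => /orP[/eqP ->|mn].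
  by rewrite subnn qbin_diag.
have -> : (n.+1 - m.+1 = (n - m.+1).+1)%N by lia.
rewrite qbinS qbinS'.
rewrite (IH m.+1) // (IH m) ?(ltnW mn) // addrC; congr (qbin _ _ + 'X^_ * _); lia.
Qed.

Definition qpoch (n : nat) : {poly F} := \prod_(1 <= i < n.+1) (1 - 'X^i).

Lemma qpoch0 : qpoch 0 = 1. Proof. by rewrite /qpoch big_geq. Qed.

Lemma qpochS n : qpoch n.+1 = qpoch n * (1 - 'X^(n.+1)).
Proof. by rewrite /qpoch big_nat_recr. Qed.

Lemma qbin_factor n m : (m <= n)%N ->
  qbin n.+1 m.+1 * (1 - 'X^(m.+1)) = qbin n m * (1 - 'X^(n.+1)).
Proof.
move=> mn; have p1 := qbinS n m; have p2 := qbinS' n m.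
have -> : qbin n.+1 m.+1 * (1 - 'X^(m.+1)) = qbin n.+1 m.+1 - 'X^(m.+1) * qbin n.+1 m.+1 by ring.
rewrite {1}p1 p2 mulrDr mulrA -exprD; have -> : (m.+1 + (n - m) = n.+1)%N by lia.
by ring.
Qed.

Lemma dvdXn_X d e : (d <= e)%N -> 'X^d %| ('X^e : {poly F}).
Proof. exact: dvdp_exp2l. Qed.

Lemma qbin_qpoch_mod n m d : (m <= n)%N -> (d <= (n - m).+1)%N ->
  'X^d %| qbin n m * qpoch m - 1.
Proof.
elim: m n => [|m IH] [|n] // mn dnm; rewrite ?qbin0 ?qpoch0 ?mulr1 ?subrr ?dvdp0 //.
rewrite qpochS mulrA mulrAC qbin_factor //.
rewrite (_ : _ - 1 = (qbin n m * qpoch m - 1) * (1 - 'X^(n.+1)) - 'X^(n.+1)); last by ring.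
by rewrite dvdp_sub ?dvdp_mulr ?IH ?dvdXn_X //; lia.
Qed.

Lemma qpoch_mod m N d : (m <= N)%N -> (d <= m.+1)%N -> 'X^d %| qpoch N - qpoch m.
Proof.
move=> mN dm; elim: N mN => [|N IH]; first by rewrite leqn0 => /eqP ->; rewrite subrr dvdp0.
rewrite leq_eqVlt => /orP[/eqP ->|mN]; first by rewrite subrr dvdp0.
rewrite qpochS (_ : _ - _ = (qpoch N - qpoch m) - qpoch N * 'X^(N.+1)); last by ring.
by rewrite dvdp_sub ?IH // dvdp_mull // dvdXn_X //; lia.
Qed.

Definition jweight (s : int) : {poly F} := ((-1) ^ s * (2 * s - 1)%:~R) *: 'X^(tri s).

(** A finite form of Jacobi's sum: the Gaussian binomial tends to the inverse of the
    Euler product as N grows. *)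
Definition jacobi_sum N : {poly F} :=
  \sum_(0 <= m < (2 * N).+2) jweight (m%:Z - N%:Z) * qbin (2 * N).+1 m.

Lemma sum_predecessor (n : nat) (a g : nat -> {poly F}) :
  \sum_(0 <= m < n.+1) a m * (if m is m'.+1 then g m' else 0) =
  \sum_(0 <= m < n) a m.+1 * g m.
Proof. by rewrite big_nat_recl // mulr0 add0r. Qed.

(** Both Pascal rules in turn; raising N by one raises the upper index by two. *)
Lemma qbin_two_steps N m :
  (m <= (2 * N).+3)%N ->
  qbin (2 * N).+3 m = 'X^m * qbin (2 * N).+1 m +
    (1 + 'X^((2 * N).+2)) * (if m is m'.+1 then qbin (2 * N).+1 m' else 0) +
    'X^((2 * N).+3 - m) * (if m is m'.+2 then qbin (2 * N).+1 m' else 0).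
Proof.
case: m => [|[|m]] mN.
- by rewrite !qbin0 expr0; ring.
- rewrite qbinS qbinS' // !qbin0 subn0 !mulr1 mulrDr -exprD add1n; ring.
rewrite qbinS [qbin (2 * N).+2 m.+2]qbinS' [qbin (2 * N).+2 m.+1]qbinS' mulrDr mulrA -exprD.
case: (leqP m.+1 (2 * N).+1) => mN'; last first.
  have [z1 z2] : qbin (2 * N).+1 m.+1 = 0 /\ qbin (2 * N).+1 m.+2 = 0.
    by rewrite !qbin_small //; lia.
  rewrite z1 z2.
  by rewrite !subSS; ring.
have -> : (m.+2 + ((2 * N).+1 - m.+1) = (2 * N).+2)%N by lia.
by rewrite !subSS; ring.
Qed.

(** The three weights that multiply the same Gaussian binomial combine into one factor:
    (2s-1)(1 + y^2) - (2s-3) y - (2s+1) y = (2s-1)(1-y)^2 with y = X^(N+1). *)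
Lemma jweightS N (p : nat) : (p < (2 * N).+2)%N ->
  jweight (p%:Z - N.+1%:Z) * 'X^p + jweight (p.+1%:Z - N.+1%:Z) * (1 + 'X^((2 * N).+2)) +
  jweight (p.+2%:Z - N.+1%:Z) * 'X^((2 * N).+3 - p.+2) =
  (1 - 'X^(N.+1)) ^+ 2 * jweight (p%:Z - N%:Z).
Proof.
move=> pN; set s := p%:Z - N%:Z.
have -> : p%:Z - N.+1%:Z = s - 1 by rewrite /s; lia.
have -> : p.+1%:Z - N.+1%:Z = s by rewrite /s; lia.
have -> : p.+2%:Z - N.+1%:Z = s + 1 by rewrite /s; lia.
rewrite /jweight -!scalerAl -!exprD.
have -> : (tri (s - 1) + p = tri s + N.+1)%N.
  by have := tri_eq s; have := tri_eq (s - 1); rewrite /s; nia.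
have -> : (tri (s + 1) + ((2 * N).+3 - p.+2) = tri s + N.+1)%N.
  by have := tri_eq s; have := tri_eq (s + 1); rewrite /s; nia.
have -> : (-1) ^ (s - 1) = - (-1) ^ s :> F by rewrite sgnD sgnN expr1z mulrN1.
have -> : (-1) ^ (s + 1) = - (-1) ^ s :> F by rewrite sgnD expr1z mulrN1.
rewrite exprD -!mul_polyC.
have -> : (2 * N).+2 = (N.+1 * 2)%N by lia.
rewrite [in LHS]exprM.
have -> : (2 * (s - 1) - 1)%:~R = (2 * s - 1)%:~R - 2%:R :> F.
  by rewrite (_ : 2 * (s - 1) - 1 = (2 * s - 1) - 2) ?rmorphB //; ring.
have -> : (2 * (s + 1) - 1)%:~R = (2 * s - 1)%:~R + 2%:R :> F.
  by rewrite (_ : 2 * (s + 1) - 1 = (2 * s - 1) + 2) ?rmorphD //; ring.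
rewrite !(polyCM, polyCD, polyCN, polyC1).
move: ('X^(N.+1) : {poly F}) ('X^(tri s) : {poly F}) => x y; ring.
Qed.

Lemma jacobi_sumE N : jacobi_sum N = - (2%:R * qpoch N ^+ 2).
Proof.
elim: N => [|N IH].
  rewrite /jacobi_sum muln0 qpoch0 big_ltn // big_ltn // big_geq // qbin0 qbin_diag.
  rewrite /jweight; have -> : tri (0%:Z - 0%:Z) = 0%N by [].
  have -> : tri (1%:Z - 0%:Z) = 0%N by [].
  rewrite subrr subr0 expr0z expr1z expr0 -!mul_polyC !(polyCM, polyCN, polyC1).
  by ring.
have N2 : (2 * N.+1 = (2 * N).+2)%N by lia.
have -> : - (2%:R * qpoch N.+1 ^+ 2) = (1 - 'X^(N.+1)) ^+ 2 * jacobi_sum N.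
  by rewrite IH qpochS; ring.
rewrite /jacobi_sum N2 big_distrr.
pose w m := jweight (m%:Z - N.+1%:Z).
pose G m := qbin (2 * N).+1 m.
pose G1 m := if m is m'.+1 then G m' else 0.
have GL m : (m >= (2 * N).+2)%N -> G m = 0 by move=> h; rewrite /G qbin_small.
transitivity (\sum_(0 <= m < (2 * N).+4) ((w m * 'X^m) * G m +
   ((w m * (1 + 'X^((2 * N).+2))) * G1 m +
    (w m * 'X^((2 * N).+3 - m)) * (if m is m'.+1 then G1 m' else 0)))).
  apply: eq_big_nat => m /andP[_ hm]; rewrite -/(w m) qbin_two_steps //.
  by rewrite /G1 /G; case: m hm => [|[|m]] hm; ring.
have cut3 b : \sum_(0 <= m < (2 * N).+3) b m * G m = \sum_(0 <= m < (2 * N).+2) b m * G m.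
  by rewrite big_nat_recr //= GL // mulr0 addr0.
have cut4 b : \sum_(0 <= m < (2 * N).+4) b m * G m = \sum_(0 <= m < (2 * N).+2) b m * G m.
  by rewrite big_nat_recr //= GL // mulr0 addr0 cut3.
have S1 b n : \sum_(0 <= m < n.+1) b m * G1 m = \sum_(0 <= m < n) b m.+1 * G m.
  exact: sum_predecessor.
rewrite !big_split /= cut4 S1 cut3 sum_predecessor S1 -!big_split /=.
apply: eq_big_nat => p /andP[_ hp].
by rewrite mulrA -[_ * jweight _]mulrC mulrC -jweightS // /w /G; ring.
Qed.

(** After multiplication by the Euler product, the m-th term of jacobi_sum has its
    binomial replaced by 1 up to order min(m, 2M+1-m) + 1; the power of X in its weight
    makes up for what this order lacks to reach M. *)
Theorem jacobi_cube M : 'X^M %| theta_moment F M 1 + 2%:R *: qpoch M ^+ 3.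
Proof.
have tauE : 'X^M %| theta_moment F M 1 - \sum_(0 <= m < (2 * M).+2) jweight (m%:Z - M%:Z).
  have -> : theta_moment F M 1 = \sum_(0 <= m < (2 * M).+1) jweight (m%:Z - M%:Z).
    rewrite /theta_moment /lattice_poly big_zbox big_mkord mul2n -addnn.
    by apply: eq_bigr => m _; rewrite expr1.
  rewrite [in X in _ - X]big_nat_recr //= opprD addrA subrr sub0r dvdpNr.
  rewrite /jweight -mul_polyC dvdp_mull // dvdXn_X //.
  by have := tri_eq ((2 * M).+1%:Z - M%:Z); nia.
have bin1 m2 : (m2 <= M)%N -> 'X^(m2.+1) %| qbin (2 * M).+1 m2 * qpoch M - 1.
  move=> mM; rewrite (_ : _ - 1 = qbin (2 * M).+1 m2 * (qpoch M - qpoch m2) +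
    (qbin (2 * M).+1 m2 * qpoch m2 - 1)); last by ring.
  by rewrite dvdp_add ?dvdp_mull ?qpoch_mod ?qbin_qpoch_mod //; lia.
have sumE : 'X^M %| \sum_(0 <= m < (2 * M).+2) jweight (m%:Z - M%:Z) - jacobi_sum M * qpoch M.
  rewrite /jacobi_sum mulr_suml -sumrB big_nat_cond; apply: dvdp_sum => m /andP[/andP[_ hm] _].
  rewrite -mulrA -{1}[jweight _]mulr1 -mulrBr -dvdpNr -mulrN opprB.
  have [m2 [m2M qE tE]] : exists m2, [/\ (m2 <= M)%N,
      qbin (2 * M).+1 m = qbin (2 * M).+1 m2 & (M - m2 <= tri (m%:Z - M%:Z))%N].
    have t2 := tri_eq (m%:Z - M%:Z).
    case: (leqP m M) => mM; first by exists m; split => //; nia.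
    (* The Gaussian binomial and its exponent are symmetric under m |-> 2M+1-m. *)
    exists ((2 * M).+1 - m)%N; split; [by lia | by rewrite qbin_sym //; lia | by nia].
  rewrite qE; apply: (@dvdp_trans _ ('X^(M - m2) * 'X^(m2.+1))).
    by rewrite -exprD dvdXn_X //; lia.
  by rewrite dvdp_mul ?bin1 // /jweight -mul_polyC dvdp_mull // dvdXn_X.
rewrite (_ : _ + _ = (theta_moment F M 1 - \sum_(0 <= m < (2 * M).+2) jweight (m%:Z - M%:Z)) +
  (\sum_(0 <= m < (2 * M).+2) jweight (m%:Z - M%:Z) - jacobi_sum M * qpoch M)).
  exact: dvdp_add.
by rewrite jacobi_sumE -mul_polyC polyC_natr; ring.
Qed.
End Jacobi.

(** * The identity between power series *)
Section FormalIdentity.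
Variable F : numFieldType.

Lemma dvdXn_X_deriv M (p : {poly F}) : 'X^M %| p -> 'X^M %| 'X * p^`().
Proof.
move=> /dvdXnP h; apply/dvdXnP => e eM; rewrite coefXM.
by case: e eM => // e eM; rewrite coef_deriv h // mul0rn.
Qed.

Lemma qpoch_coef0 M : (qpoch F M)`_0 = 1.
Proof.
rewrite -horner_coef0 horner_prod big1_seq // => i /andP[_].
rewrite mem_index_iota => /andP[i0 _].
by rewrite !hornerE expr0n eqn0Ngt i0 subr0.
Qed.

(** At the coefficient of X^e only e Z_e P_0 survives once the lower coefficients of Z
    are known to vanish. *)
Lemma log_ode_unique M (c : F) (P Z : {poly F}) : P`_0 = 1 -> Z`_0 = 0 ->
  'X^M %| P * ('X * Z^`()) - c *: ('X * P^`() * Z) -> 'X^M %| Z.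
Proof.
move=> P0 Z0 /dvdXnP h; apply/dvdXnP => e; elim/ltn_ind: e => e IH eM.
case: e => [|e] in IH eM *; first exact: Z0.
have := h e.+1 eM; rewrite coefB coefZ !coefM.
rewrite big_ord_recl /= P0 mul1r subn0 coefXM /= coef_deriv big1 ?addr0; last first.
  move=> i _; rewrite /bump /= coefXM; case: eqP => [_|ie]; first by rewrite mulr0.
  by rewrite coef_deriv prednK ?IH ?mul0rn ?mulr0 //; have := ltn_ord i; lia.
rewrite big_ord_recl /= coefXM eqxx mul0r add0r big1 ?mulr0 ?subr0; last first.
  move=> i _; rewrite IH ?mulr0 //= /bump /=; have := ltn_ord i; lia.
by move/eqP; rewrite mulrn_eq0 /= => /eqP.
Qed.

Definition discr0 k : F :=
  \prod_(i < k) \prod_(j < k | (i < j)%N)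
     (((2 * j + 1) ^ 2)%N%:R - ((2 * i + 1) ^ 2)%N%:R).

(** The exponent is at least each |n_i|, so only the origin of the box contributes. *)
Lemma box_poly_coef0 k M : (box_poly F k M)`_0 = discr0 k.
Proof.
have M1 : (M < (M + M).+1)%N by lia.
pose g0 : {ffun 'I_k -> 'I_(M + M).+1} := [ffun _ => Ordinal M1].
have z0 i : zpoint (g0 i) = 0 by rewrite /zpoint ffunE subrr.
have node_exp0 i : node_exp k i 0 = 0%N by rewrite /node_exp expr2 !mulr0.
rewrite coef_sum (bigD1 g0) //= big1 => [|g gg0].
  rewrite addr0 coefZ coefXn /box_exp.
  rewrite (eq_bigr (fun=> 0%N)) => [|i _]; last by rewrite z0 node_exp0.
  rewrite sum_nat_const muln0 eqxx mulr1 /box_sign big1 => [|i _]; last by rewrite z0 expr0z.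
  rewrite mul1r; apply: eq_bigr => i _; apply: eq_bigr => j _.
  by rewrite /box_node_sq !z0 /node !mul0r !addr0 !natrX -!pmulrn.
rewrite coefZ coefXn; case: eqP => [he|_]; last by rewrite mulr0.
case/eqP: gg0; apply/ffunP => i; apply: val_inj; rewrite ffunE /=.
have : (node_exp k i (zpoint (g i)) <= box_exp g)%N.
  by rewrite /box_exp (bigD1 i) //= leq_addr.
by have := node_exp_ge (zpoint (g i)) (ltn_ord i); rewrite -he /zpoint; lia.
Qed.

Theorem box_poly_eta k M : (2 <= k)%N ->
  'X^M %| box_poly F k M - discr0 k *: qpoch F M ^+ (k * (2 * k - 1)).
Proof.
move=> k2; case: (posnP M) => [->|M0]; first by rewrite expr0 dvd1p.
set W := box_poly F k M; set P := qpoch F M; set m := (k * (2 * k - 1))%N.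
have m0 : (0 < m)%N by rewrite /m; nia.
have := @box_poly_theta_ode F k M M0 k2; rewrite -/W -/m => h.
have := jacobi_cube F M; rewrite -/P; set t := theta_moment F M 1 in h * => tP.
have P0 : P`_0 = 1 by exact: qpoch_coef0.
have ode : 'X^M %| P * ('X * W^`()) - m%:R *: ('X * P^`() * W).
  apply: (@dvdXn_cancel _ M (6%:R *: P ^+ 2)).
    by rewrite coefZ expr2 coef0M P0 !mulr1 pnatr_eq0.
  have tP' := dvdXn_X_deriv tP.
  rewrite (_ : _ * _ = 3%:R * ('X * W^`()) * (t + 2%:R *: P ^+ 3) - m%:R * W * ('X * (t + 2%:R *: P ^+ 3)^`())
    - (3%:R *: (t * ('X * W^`())) - m%:R *: ('X * t^`() * W))).
    apply: dvdp_sub; last exact: h.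
    by apply: dvdp_sub; apply: dvdp_mull.
  rewrite derivD derivZ deriv_exp /= -mulr_natr -!mul_polyC !polyC_natr; ring.
have mE : exists m', m = m'.+1 by exists m.-1; rewrite prednK.
apply: (@log_ode_unique _ m%:R P) => //.
  have Pm0 : (P ^+ m)`_0 = 1 by rewrite -horner_coef0 horner_exp horner_coef0 P0 expr1n.
  by rewrite coefB coefZ Pm0 mulr1 box_poly_coef0 subrr.
rewrite (_ : _ - _ = P * ('X * W^`()) - m%:R *: ('X * P^`() * W)) //.
rewrite derivB derivZ deriv_exp -mulr_natr -!mul_polyC !polyC_natr.
have [m' ->] := mE; rewrite exprS /=; ring.
Qed.
End FormalIdentity.

(** * Majorants *)
Section Domination.
Variable F : numFieldType.
Implicit Types p q P Q : {poly F}.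

Definition dominated p P := forall i, `|p`_i| <= P`_i.

Lemma dominated_ge0 p P i : dominated p P -> 0 <= P`_i.
Proof. by move=> /(_ i); apply: le_trans. Qed.

Lemma dominatedD p q P Q : dominated p P -> dominated q Q -> dominated (p + q) (P + Q).
Proof. by move=> hp hq i; rewrite !coefD (le_trans (ler_normD _ _)) // lerD. Qed.

Lemma dominatedN p P : dominated p P -> dominated (- p) P.
Proof. by move=> hp i; rewrite coefN normrN. Qed.

Lemma dominatedM p q P Q : dominated p P -> dominated q Q -> dominated (p * q) (P * Q).
Proof.
move=> hp hq i; rewrite !coefM (le_trans (ler_norm_sum _ _ _)) // ler_sum // => j _.
by rewrite normrM ler_pM.
Qed.

Lemma dominatedZ c p P : dominated p P -> dominated (c *: p) (`|c| *: P).
Proof. by move=> hp i; rewrite !coefZ normrM ler_wpM2l. Qed.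

Lemma dominated_Xn n : dominated 'X^n 'X^n.
Proof. by move=> i; rewrite coefXn normr_nat. Qed.

Lemma dominated1 : dominated 1 1.
Proof. by move=> i; rewrite coef1 normr_nat. Qed.

Lemma dominated_sum (I : Type) (s : seq I) (f g : I -> {poly F}) :
  (forall i, dominated (f i) (g i)) -> dominated (\sum_(i <- s) f i) (\sum_(i <- s) g i).
Proof.
move=> h; elim/big_ind2: _ => [i|*|i _]; [by rewrite coef0 normr0 | | exact: h].
exact: dominatedD.
Qed.

Lemma dominated_prod (I : Type) (s : seq I) (f g : I -> {poly F}) :
  (forall i, dominated (f i) (g i)) -> dominated (\prod_(i <- s) f i) (\prod_(i <- s) g i).
Proof.
move=> h; elim/big_ind2: _ => [|*|i _]; [exact: dominated1 | | exact: h].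
exact: dominatedM.
Qed.

Lemma dominated_exp p P n : dominated p P -> dominated (p ^+ n) (P ^+ n).
Proof.
move=> h; elim: n => [|n IH]; first by rewrite !expr0; exact: dominated1.
by rewrite !exprS; exact: dominatedM.
Qed.

(** Each power x^i with i >= K yields t^i <= t^K, and r^i is kept for the majorant. *)
Lemma dominated_tail K (t r x : F) p P : dominated p P -> 'X^K %| p ->
  0 <= t <= 1 -> 0 <= r -> `|x| = t * r -> `|p.[x]| <= t ^+ K * P.[r].
Proof.
move=> hp /dvdXnP pK /andP[t0 t1] r0 xE.
set n := maxn (size p) (size P).
rewrite (@horner_coef_wide _ n) ?leq_maxl // (@horner_coef_wide _ n P) ?leq_maxr //.
rewrite mulr_sumr (le_trans (ler_norm_sum _ _ _)) // ler_sum // => i _.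
have Pi := @dominated_ge0 p P i hp.
case: (ltnP i K) => iK; first by rewrite pK // mul0r normr0 !mulr_ge0 ?exprn_ge0.
rewrite normrM normrX xE exprMn mulrA [_ ^+ K * _]mulrA ler_wpM2r ?exprn_ge0 //.
rewrite mulrC ler_pM ?exprn_ge0 //.
by rewrite -(subnK iK) exprD ler_piMl ?exprn_ge0 ?exprn_ile1.
Qed.

Lemma geometric_sum_le (t : F) n : 0 <= t < 1 -> \sum_(i < n) t ^+ i <= (1 - t)^-1.
Proof.
move=> /andP[t0 t1]; have h : 0 < 1 - t by rewrite subr_gt0.
rewrite -(ler_pM2l h) divff ?lt0r_neq0 //.
have := subrXX 1 t n; rewrite expr1n.
under [in X in _ = X -> _]eq_bigr do rewrite expr1n mul1r.
by move=> <-; rewrite lerBlDr lerDl exprn_ge0.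
Qed.

(** The n+1 powers t^0, ..., t^n are all at least t^n. *)
Lemma geometric_weight (t : F) n : 0 <= t < 1 -> (n.+1)%:R * t ^+ n <= (1 - t)^-1.
Proof.
move=> /[dup] t01 /andP[t0 t1]; apply: le_trans (geometric_sum_le n.+1 t01).
rewrite mulr_natl -[n.+1 in leLHS]card_ord -sumr_const.
apply: ler_sum => i _; apply: ler_wiXn2l => //; first exact: ltW.
by rewrite -ltnS.
Qed.

Lemma zbox_geometric (t : F) K : 0 <= t < 1 ->
  \sum_(n <- zbox K) t ^+ absz n <= 2%:R * (1 - t)^-1.
Proof.
move=> /andP[t0 t1]; have h : 0 < 1 - t by rewrite subr_gt0.
suff -> : \sum_(n <- zbox K) t ^+ absz n = (2%:R - (1 - t) - 2%:R * t ^+ K.+1) / (1 - t).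
  rewrite ler_wpM2r ?invr_ge0 ?(ltW h) // -subr_ge0.
  rewrite (_ : _ - _ = (1 - t) + 2%:R * t ^+ K.+1); last by ring.
  by rewrite addr_ge0 ?(ltW h) // mulr_ge0 ?exprn_ge0.
elim: K => [|K IH].
  by rewrite /zbox big_seq1 subrr expr0 expr1; field; rewrite lt0r_neq0.
have -> : \sum_(n <- zbox K.+1) t ^+ absz n =
    \sum_(n <- [:: - K.+1%:Z, K.+1%:Z & zbox K]) t ^+ absz n.
  apply: perm_big; apply: uniq_perm; rewrite ?zbox_uniq // 2?cons_uniq.
    by rewrite zbox_uniq inE !mem_zbox; lia.
  by move=> n; rewrite mem_zbox 2!in_cons mem_zbox; lia.
by rewrite 2!big_cons IH abszN /= [t ^+ K.+2]exprS; field; rewrite lt0r_neq0.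
Qed.

End Domination.

(** * Decay of the terms of the lattice series *)
Section LatticeMajorant.
Variables (F : numFieldType) (k : nat).
Implicit Type n : {ffun 'I_k -> int}.

Lemma node_idx (i : 'I_k) (x : int) :
  2 * idx i - 1 + x * (4 * k%:Z + 2) = node k i x.
Proof. by rewrite /idx /node; lia. Qed.

Lemma chiDE n : chiD n =
  \prod_(i < k) \prod_(j < k | (i < j)%N) (node k i (n i) ^+ 2 - node k j (n j) ^+ 2).
Proof. by apply: eq_bigr => i _; apply: eq_bigr => j _; rewrite !node_idx. Qed.

Definition height n : int := \prod_(l < k) (1 + node k l (n l) ^+ 2).

Lemma height_ge n (l : 'I_k) : 1 + node k l (n l) ^+ 2 <= height n.
Proof.
rewrite /height (bigD1 l) //= ler_peMr ?addr_ge0 ?sqr_ge0 //.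
by elim/big_ind: _ => // [|i _]; [exact: mulr_ege1 | rewrite lerDl sqr_ge0].
Qed.

(** There are at most k^2 factors, and the height, which is at least 1, bounds each. *)
Lemma chiD_le n : `|chiD n| <= height n ^+ (k * k).
Proof.
have h1 : 1 <= height n.
  by rewrite /height; elim/big_ind: _ => // [|i _]; [exact: mulr_ege1 | rewrite lerDl sqr_ge0].
have hk : \prod_(i < k) height n ^+ k = height n ^+ (k * k).
  by rewrite prodr_const card_ord exprM.
rewrite chiDE -hk normr_prod; apply: ler_prod => i _; rewrite normr_ge0 /=.
rewrite normr_prod big_mkcond -[in leRHS](card_ord k) -prodr_const.
apply: ler_prod => j _; case: ifP => _; last by rewrite ler01.
rewrite normr_ge0 /=; have := height_ge n i; have := height_ge n j.
by have := sqr_ge0 (node k i (n i)); have := sqr_ge0 (node k j (n j)); lia.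
Qed.

Definition lattice_exp n : nat := \sum_(l < k) node_exp k l (n l).
Definition dist_weight (t : F) n : F := \prod_(l < k) t ^+ absz (n l).

(** The constant of lattice_majorant, one factor for each coordinate. *)
Definition growth (t : F) : F :=
  (((1 + (4 * k + 2) ^ 2)%N%:R ^+ (k * k)) * ((1 - t)^-1) ^+ (2 * (k * k))) ^+ k.

Lemma growth_ge0 t : 0 <= t < 1 -> 0 <= growth t.
Proof.
move=> /andP[t0 t1]; rewrite exprn_ge0 // mulr_ge0 ?exprn_ge0 ?ler0n //.
by rewrite invr_ge0 subr_ge0 ltW.
Qed.

Lemma dist_weight_ge0 t n : 0 <= t -> 0 <= dist_weight t n.
Proof. by move=> t0; apply: prodr_ge0 => l _; rewrite exprn_ge0. Qed.

Lemma node_le (l : 'I_k) x :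
  1 + node k l x ^+ 2 <= (1 + (4 * k + 2) ^ 2)%N%:Z * ((absz x).+1)%:Z ^+ 2.
Proof.
have lk := ltn_ord l.
have : `|node k l x| <= (4 * k + 2)%N%:Z * ((absz x).+1)%:Z.
  rewrite /node (le_trans (ler_normD _ _)) // normrM.
  have -> : `|x| = (absz x)%:Z by [].
  by rewrite !ger0_norm //; nia.
move=> h; have h2 : node k l x ^+ 2 <= ((4 * k + 2)%N%:Z * ((absz x).+1)%:Z) ^+ 2.
  by rewrite -(ger0_norm (sqr_ge0 (node k l x))) normrX lerXn2r ?nnegrE // mulr_ge0.
have h3 : 1 <= ((absz x).+1)%:Z ^+ 2 by rewrite exprn_ege1.
rewrite exprMn in h2.
have -> : (1 + (4 * k + 2) ^ 2)%N%:Z = 1 + (4 * k + 2)%N%:Z ^+ 2 by lia.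
by rewrite mulrDl mul1r lerD.
Qed.

(** chiD is polynomial of degree at most 2k^2 in each coordinate, and (1+|n|) t^|n| is
    bounded: 2k^2 factors t^|n| absorb it and two remain, one for the size of the tail and
    one for summability. *)
Lemma lattice_majorant (t : F) n : 0 <= t < 1 ->
  `|(chiD n)%:~R| * (t ^+ (2 * (k * k) + 2)) ^+ lattice_exp n <=
  growth t * dist_weight (t ^+ 2) n.
Proof.
move=> /[dup] t01 /andP[t0 t1]; set kk := (k * k)%N; set r := t ^+ _.
have r0 : 0 <= r by rewrite exprn_ge0.
have r1 : r <= 1 by rewrite exprn_ile1 // ltW.
have it0 : 0 <= (1 - t)^-1 by rewrite invr_ge0 subr_ge0 ltW.
apply: (@le_trans _ _ ((height n)%:~R ^+ kk * r ^+ (\sum_(l < k) absz (n l)))).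
  rewrite ler_pM ?normr_ge0 ?exprn_ge0 //.
    by rewrite -intr_norm -rmorphXn ler_int chiD_le.
  rewrite ler_wiXn2l // /lattice_exp; apply: leq_sum => l _; exact: node_exp_ge.
have -> : (height n)%:~R ^+ kk * r ^+ (\sum_(l < k) absz (n l)) =
    \prod_(l < k) ((1 + node k l (n l) ^+ 2)%:~R ^+ kk * r ^+ absz (n l)).
  by rewrite /height rmorph_prod big_split prodrXl -prodrXr.
have -> : growth t * dist_weight (t ^+ 2) n =
    \prod_(l < k) (((1 + (4 * k + 2) ^ 2)%N%:R ^+ kk) * ((1 - t)^-1) ^+ (2 * kk) *
       (t ^+ 2) ^+ absz (n l)).
  by rewrite big_split prodr_const card_ord.
apply: ler_prod => l _; set x := n l; set D := (_ ^ 2)%N.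
have A0 : 0 <= (1 + node k l x ^+ 2)%:~R :> F by rewrite ler0z addr_ge0 // sqr_ge0.
rewrite mulr_ge0 ?exprn_ge0 //=.
have hA : (1 + node k l x ^+ 2)%:~R <= (1 + D)%N%:R * (absz x).+1%:R ^+ 2 :> F.
  by have := node_le l x; rewrite -(ler_int F) rmorphM rmorphXn.
have -> : r ^+ absz x = (t ^+ absz x) ^+ (2 * kk) * (t ^+ 2) ^+ absz x.
  by rewrite /r -!exprM -exprD; congr (_ ^+ _); lia.
rewrite mulrA ler_wpM2r ?exprn_ge0 //.
apply: (@le_trans _ _ (((1 + D)%N%:R * (absz x).+1%:R ^+ 2) ^+ kk * (t ^+ absz x) ^+ (2 * kk))).
  by rewrite ler_wpM2r ?exprn_ge0 // lerXn2r ?nnegrE // mulr_ge0 ?exprn_ge0 ?ler0n.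
rewrite exprMn -mulrA ler_wpM2l ?exprn_ge0 ?ler0n // -[(_ ^+ 2) ^+ kk]exprM -exprMn.
rewrite lerXn2r ?nnegrE //; first by rewrite mulr_ge0 ?exprn_ge0 ?ler0n.
exact: geometric_weight.
Qed.

End LatticeMajorant.

Section SeqSums.
Variables (T : eqType) (V : nmodType).

Lemma big_uniq_split (s A : seq T) (f : T -> V) : uniq s -> uniq A -> {subset A <= s} ->
  \sum_(x <- s) f x = \sum_(x <- A) f x + \sum_(x <- s | x \notin A) f x.
Proof.
move=> us uA As; rewrite (bigID (mem A)) /= -[in LHS]big_filter; congr (_ + _).
apply: perm_big; apply: uniq_perm; rewrite ?filter_uniq // => x.
rewrite mem_filter; case: (boolP (x \in A)) => // /As ->; by [].
Qed.
End SeqSums.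

(** * Sums over boxes and over arbitrary finite sets *)
Section Boxes.
Variables (F : numFieldType) (k : nat).
Implicit Type n : {ffun 'I_k -> int}.

Definition box_point K (g : {ffun 'I_k -> 'I_(K + K).+1}) : {ffun 'I_k -> int} :=
  [ffun i => zpoint (g i)].

Lemma box_point_inj K : injective (@box_point K).
Proof.
move=> g h /ffunP gh; apply/ffunP => i; apply: val_inj.
by have := gh i; rewrite !ffunE /zpoint /=; lia.
Qed.

Definition box K : {fset {ffun 'I_k -> int}} :=
  [fset box_point g | g in {: {ffun 'I_k -> 'I_(K + K).+1}}]%fset.

Lemma mem_box K n : (n \in box K) = [forall i, absz (n i) <= K]%N.
Proof.
apply/imfsetP/forallP => [[g _ ->] i|h].
  by rewrite ffunE /zpoint; have := ltn_ord (g i); move: (nat_of_ord (g i)) => x; lia.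
have hb i : (absz (n i + K%:Z)%R < (K + K).+1)%N by have := h i; lia.
exists [ffun i => Ordinal (hb i)] => //; apply/ffunP => i.
by rewrite !ffunE /zpoint /=; have := h i; lia.
Qed.

Lemma sum_box (V : nmodType) K (f : {ffun 'I_k -> int} -> V) :
  \sum_(n <- box K) f n = \sum_(g : {ffun 'I_k -> 'I_(K + K).+1}) f (box_point g).
Proof.
rewrite big_imfset /=; last by move=> g h _ _; apply: box_point_inj.
by rewrite big_enum.
Qed.

Lemma sum_dist_weight_box (t : F) K : 0 <= t < 1 ->
  \sum_(n <- box K) dist_weight t n <= (2%:R * (1 - t)^-1) ^+ k.
Proof.
move=> /[dup] t01 /andP[t0 t1]; rewrite sum_box.
have -> : \sum_(g : {ffun 'I_k -> 'I_(K + K).+1}) dist_weight t (box_point g) =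
  \prod_(l < k) \sum_(x < (K + K).+1) t ^+ absz (zpoint x).
  rewrite bigA_distr_bigA; apply: eq_bigr => g _; apply: eq_bigr => l _.
  by rewrite ffunE.
rewrite -[k in leRHS]card_ord -prodr_const; apply: ler_prod => l _.
rewrite -(big_zbox _ (fun x : int => t ^+ absz x)) zbox_geometric // andbT.
by apply: sumr_ge0 => x _; rewrite exprn_ge0.
Qed.

Lemma sum_dist_weight (t : F) (B : {fset {ffun 'I_k -> int}}) : 0 <= t < 1 ->
  \sum_(n <- B) dist_weight t n <= (2%:R * (1 - t)^-1) ^+ k.
Proof.
move=> /[dup] t01 /andP[t0 t1].
pose K := (\sum_(n <- B) \sum_(l < k) absz (n l))%N.
apply: le_trans (sum_dist_weight_box K t01).
rewrite (@big_uniq_split _ _ (box K) B) ?fset_uniq //.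
  by rewrite lerDl; apply: sumr_ge0 => n _; apply: dist_weight_ge0.
move=> n nB; rewrite mem_box; apply/forallP => l.
rewrite /K (big_rem n) //= (bigD1 l) //= -addnA; exact: leq_addr.
Qed.

Lemma dist_weight_outside (t : F) K n : 0 <= t < 1 -> n \notin box K ->
  dist_weight (t ^+ 2) n <= t ^+ K * dist_weight t n.
Proof.
move=> /andP[t0 t1]; rewrite mem_box negb_forall => /existsP[l hl].
have -> : dist_weight (t ^+ 2) n = dist_weight t n * dist_weight t n.
  by rewrite /dist_weight -big_split; apply: eq_bigr => i _ /=; rewrite exprAC expr2.
rewrite ler_wpM2r ?dist_weight_ge0 // /dist_weight (bigD1 l) //=.
apply: (@le_trans _ _ (t ^+ absz (n l))).
  rewrite ler_piMr ?exprn_ge0 //; apply: prodr_ile1 => i _.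
  by rewrite exprn_ge0 // exprn_ile1 // ltW.
by apply: ler_wiXn2l => //; [exact: ltW | rewrite ltnW // ltnNge].
Qed.
End Boxes.

(** * Distance from a box sum to its limit *)
Section Estimates.
Variables (F : numFieldType) (k : nat) (t q : F).
Hypothesis (t01 : 0 <= t < 1) (qE : `|q| = t * t ^+ (2 * (k * k) + 2)).

Let t0 : 0 <= t. Proof. by case/andP: t01. Qed.
Let r := t ^+ (2 * (k * k) + 2).
Let r0 : 0 <= r. Proof. by rewrite exprn_ge0. Qed.

Definition lattice_term (n : {ffun 'I_k -> int}) : F :=
  (-1) ^ (\sum_(i < k) n i) * (chiD n)%:~R * q ^+ lattice_exp n.

Lemma sgn_sum (I : Type) (s : seq I) (f : I -> int) :
  (-1) ^ (\sum_(i <- s) f i) = \prod_(i <- s) (-1) ^ (f i) :> F.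
Proof. by elim/big_rec2: _ => [|i x y _ <-]; rewrite ?expr0z ?sgnD. Qed.

Lemma norm_lattice_term n : `|lattice_term n| <= growth k t * dist_weight (t ^+ 2) n.
Proof.
apply: le_trans (lattice_majorant n t01).
rewrite !normrM norm_sgn mul1r ler_wpM2l // normrX qE.
rewrite -/r lerXn2r ?nnegrE ?mulr_ge0 // ler_piMl //.
by case/andP: t01 => _ /ltW.
Qed.

Definition tail_const : F := growth k t * (2%:R * (1 - t)^-1) ^+ k.

(** Outside the box one of the two remaining factors gives t^K, the other is summable. *)
Lemma lattice_term_tail K (B : {fset {ffun 'I_k -> int}}) : {subset box k K <= B} ->
  `|\sum_(n <- B) lattice_term n - \sum_(n <- box k K) lattice_term n| <= t ^+ K * tail_const.
Proof.
move=> AB; rewrite (@big_uniq_split _ _ B (box k K)) ?fset_uniq // addrC addKr.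
apply: (le_trans (ler_norm_sum _ _ _)).
apply: (@le_trans _ _ (\sum_(n <- B | n \notin box k K) growth k t * (t ^+ K * dist_weight t n))).
  apply: ler_sum => n nK; apply: le_trans (norm_lattice_term n) _.
  by rewrite ler_wpM2l ?growth_ge0 ?dist_weight_outside.
apply: (@le_trans _ _ (\sum_(n <- B) growth k t * (t ^+ K * dist_weight t n))).
  rewrite [leRHS](bigID (fun n => n \notin box k K)) /= lerDl.
  by apply: sumr_ge0 => n _; rewrite !mulr_ge0 ?growth_ge0 ?exprn_ge0 ?dist_weight_ge0.
rewrite -!mulr_sumr /tail_const mulrCA ler_wpM2l ?exprn_ge0 //.
by rewrite ler_wpM2l ?growth_ge0 // sum_dist_weight.
Qed.

(** The sign that relates chiD, a product of differences x_i - x_j, to the Vandermonde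
    determinant, a product of differences x_j - x_i. *)
Definition pair_sign : F := \prod_(i < k) \prod_(j < k | (i < j)%N) -1.

Lemma pair_signK : pair_sign * pair_sign = 1.
Proof.
rewrite -big_split big1 // => i _ /=; rewrite -big_split big1 // => j _ /=.
by rewrite mulrNN mulr1.
Qed.

Lemma norm_pair_sign : `|pair_sign| = 1.
Proof. by apply/eqP; rewrite -(@pexpr_eq1 _ _ 2) // -normrX expr2 pair_signK normr1. Qed.

Lemma pair_sign_flip (a : 'I_k -> F) :
  \prod_(i < k) \prod_(j < k | (i < j)%N) (a j - a i) =
  pair_sign * \prod_(i < k) \prod_(j < k | (i < j)%N) (a i - a j).
Proof.
rewrite -big_split; apply: eq_bigr => i _ /=; rewrite -big_split; apply: eq_bigr => j _ /=.
by rewrite mulN1r opprB.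
Qed.

Lemma box_discrE K (g : {ffun 'I_k -> 'I_(K + K).+1}) :
  box_discr F g = pair_sign * (chiD (box_point g))%:~R.
Proof.
rewrite /box_discr pair_sign_flip chiDE; congr (_ * _); rewrite rmorph_prod.
apply: eq_bigr => i _ /=; rewrite rmorph_prod; apply: eq_bigr => j _ /=.
by rewrite rmorphB !rmorphXn /= !ffunE.
Qed.

Lemma lattice_exp_box K (g : {ffun 'I_k -> 'I_(K + K).+1}) :
  lattice_exp (box_point g) = box_exp g.
Proof. by apply: eq_bigr => l _; rewrite ffunE. Qed.

Lemma sum_lattice_term_box K : \sum_(n <- box k K) lattice_term n = pair_sign * (box_poly F k K).[q].
Proof.
rewrite sum_box /box_poly horner_sum mulr_sumr; apply: eq_bigr => g _.
rewrite hornerZ hornerXn box_discrE /lattice_term lattice_exp_box sgn_sum /box_sign.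
rewrite (eq_bigr (fun i => (-1) ^ zpoint (g i))) => [|i _]; last by rewrite ffunE.
rewrite -[LHS]mul1r -pair_signK; ring.
Qed.

(** dominated_tail applied to the difference of the two members of box_poly_eta, which is
    divisible by X^K and has a majorant bounded at r independently of K. *)
Lemma box_estimate K (U : F) : (2 <= k)%N ->
  \prod_(1 <= i < K.+1) (1 + r ^+ i) <= U ->
  `|\sum_(n <- box k K) lattice_term n -
     pair_sign * discr0 F k * (qpoch F K).[q] ^+ (k * (2 * k - 1))|
  <= t ^+ K * (tail_const + `|discr0 F k| * U ^+ (k * (2 * k - 1))).
Proof.
move=> k2 hU; set m := (k * (2 * k - 1))%N; have h := box_poly_eta F K k2; rewrite -/m in h.
rewrite sum_lattice_term_box -mulrA -mulrBr normrM.
rewrite norm_pair_sign mul1r.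
pose P := \sum_(g : {ffun 'I_k -> 'I_(K + K).+1}) `|box_sign F g * box_discr F g| *: 'X^(box_exp g)
   + `|discr0 F k| *: (\prod_(1 <= i < K.+1) (1 + 'X^i)) ^+ m : {poly F}.
have dom : dominated (box_poly F k K - discr0 F k *: qpoch F K ^+ m) P.
  apply: dominatedD; first by apply: dominated_sum => g; apply/dominatedZ/dominated_Xn.
  apply/dominatedN/dominatedZ/dominated_exp/dominated_prod => i.
  by apply: dominatedD; [exact: dominated1 | apply/dominatedN/dominated_Xn].
have := dominated_tail dom h _ r0 qE; rewrite hornerD hornerN hornerZ horner_exp.
move=> /(_ _)/le_trans; apply; first by case/andP: t01 => -> /ltW.
rewrite ler_wpM2l ?exprn_ge0 // /P hornerD hornerZ horner_exp lerD //.
  rewrite horner_sum.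
  apply: (@le_trans _ _ (\sum_(n <- box k K) growth k t * dist_weight t n)); last first.
    by rewrite -mulr_sumr ler_wpM2l ?growth_ge0 // sum_dist_weight.
  rewrite sum_box; apply: ler_sum => g _.
  apply: (@le_trans _ _ (growth k t * dist_weight (t ^+ 2) (box_point g))).
    apply: le_trans (lattice_majorant (box_point g) t01).
    rewrite hornerZ hornerXn -lattice_exp_box ler_wpM2r ?exprn_ge0 //.
    rewrite box_discrE !normrM norm_pair_sign mul1r /box_sign normr_prod.
    by rewrite big1 ?mul1r // => i _; rewrite norm_sgn.
  rewrite ler_wpM2l ?growth_ge0 //; apply: ler_prod => l _.
  rewrite !exprn_ge0 //= -exprM mulnC exprM expr2 ler_piMl ?exprn_ge0 //.
  by rewrite exprn_ile1 //; case/andP: t01 => _ /ltW.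
rewrite ler_wpM2l // lerXn2r ?nnegrE //.
- rewrite horner_prod; apply: prodr_ge0 => i _.
  by rewrite hornerD hornerXn hornerC addr_ge0 ?exprn_ge0.
- apply: le_trans hU; apply: prodr_ge0 => i _; by rewrite addr_ge0 ?exprn_ge0.
- apply: le_trans hU; rewrite horner_prod le_eqVlt; apply/orP; left; apply/eqP.
  by apply: eq_bigr => i _; rewrite hornerD hornerXn hornerC.
Qed.
End Estimates.

(** * Complex powers of q *)
Section ComplexExponential.
Local Open Scope classical_set_scope.
Local Open Scope complex_scope.
Variable R : realType.
Implicit Types (z w tau : R[i]) (x y : rat).

Lemma cexpD z w : cexp (z + w) = cexp z * cexp w.
Proof.
case: z w => [a b] [c d]; rewrite /cexp /= expRD cosD sinD.
by apply/eqP; rewrite eq_complex; simpc; rewrite /=; apply/andP; split; apply/eqP; ring.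
Qed.

Lemma cexp0 : cexp (0 : R[i]) = 1.
Proof. by rewrite /cexp /= expR0 cos0 sin0 mul1r. Qed.

Lemma norm_cexp z : `|cexp z| = (expR (complex.Re z))%:C :> R[i].
Proof.
rewrite normrM [X in _ * X](_ : _ = 1) ?mulr1.
  by rewrite ger0_norm // lecR expR_ge0.
by rewrite normc_def /= cos2Dsin2 sqrtr1.
Qed.

Lemma ratr_complex x : ratr x = (ratr x : R)%:C :> R[i].
Proof. by rewrite (fmorph_rat (real_complex R)). Qed.

Lemma qpowD tau x y : qpow tau (x + y) = qpow tau x * qpow tau y.
Proof. by rewrite /qpow rmorphD mulrDr cexpD. Qed.

Lemma qpow0 tau : qpow tau 0 = 1.
Proof. by rewrite /qpow rmorph0 mulr0 cexp0. Qed.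

Lemma qpowMn tau x m : qpow tau (x *+ m) = qpow tau x ^+ m.
Proof.
elim: m => [|m IH]; first by rewrite mulr0n qpow0 expr0.
by rewrite mulrS qpowD IH exprS.
Qed.

Lemma qpow_nat tau (m : nat) : qpow tau m%:R = qpow tau 1 ^+ m.
Proof. exact: qpowMn. Qed.

Lemma norm_qpow tau x :
  `|qpow tau x| = (expR (- (2 * pi * complex.Im tau * ratr x)))%:C :> R[i].
Proof.
rewrite norm_cexp ratr_complex; case: tau => a b; simpc => /=.
by congr (expR _)%:C; ring.
Qed.

Lemma norm_qpow_lt1 tau x : 0 < complex.Im tau -> 0 < x -> `|qpow tau x| < 1 :> R[i].
Proof.
move=> t0 x0; rewrite norm_qpow ltcR expR_lt1 oppr_lt0.
apply: mulr_gt0; last by rewrite ltr0q.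
by apply: mulr_gt0 => //; rewrite mulr_gt0 ?pi_gt0.
Qed.

End ComplexExponential.

(** * Limits of complex sequences *)
Section ComplexLimits.
Local Open Scope classical_set_scope.
Local Open Scope complex_scope.
Variable R : realType.

(** Positive complex numbers are real, so convergence can be tested with real bounds. *)
Lemma cvgCP (T : Type) (G : set_system T) (FG : Filter G) (f : T -> CC R) (l : CC R) :
  (forall e : R, 0 < e -> \forall x \near G, `|l - f x| <= (e%:C : CC R)) ->
  f @ G --> l.
Proof.
move=> h; apply/cvgrPdist_le => eps eps0.
have epsE : eps = (complex.Re eps)%:C by rewrite RRe_real // gtr0_real.
rewrite epsE; apply: h.
by move: eps0; rewrite epsE ltcR.
Qed.

Lemma norm_le_ReIm (z : CC R) :
  `|z| <= ((`|complex.Re z| + `|complex.Im z|)%:C : CC R).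
Proof.
rewrite normc_def lecR; set a := complex.Re z; set b := complex.Im z.
have s0 : 0 <= `|a| + `|b| by rewrite addr_ge0.
rewrite -[leRHS](ger0_norm s0) -(sqrtr_sqr (`|a| + `|b|)) ler_wsqrtr //.
rewrite sqrrD !real_normK ?num_real // addrAC lerDl.
by rewrite mulrn_wge0 // mulr_ge0.
Qed.

Lemma normc_ge_Im (z : R[i]) : `|complex.Im z|%:C <= `|z|.
Proof.
have := normc_ge_Re (z * 'i); rewrite ReiNIm normrN normrM.
by rewrite [X in _ * X](_ : _ = 1) ?mulr1 // normc_def /= expr0n expr1n add0r sqrtr1.
Qed.

Lemma real_geometric_cauchy (u : nat -> R) (c t : R) : 0 <= t < 1 ->
  (forall m, `|u m.+1 - u m| <= c * t ^+ m) -> cvg (u @ \oo).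
Proof.
move=> /andP[t0 t1] h.
have hc m : 0 <= c * t ^+ m by apply: le_trans (h m).
have hs : cvgn (series (telescope u)).
  apply: normed_cvg; apply: (@series_le_cvg _ _ (geometric c t)).
  - by move=> m /=; rewrite normr_ge0.
  - exact: hc.
  - exact: h.
  - by apply: is_cvg_geometric_series; rewrite ger0_norm.
rewrite telescopeK in hs.
have -> : u = (fun m => (u m - u 0%N) + u 0%N) by apply/funext => m; rewrite subrK.
by apply: is_cvgD => //; exact: is_cvg_cst.
Qed.

(** Completeness is used on the real and imaginary parts separately. *)
Lemma complex_geometric_cauchy (u : nat -> CC R) (c t : R) : 0 <= t < 1 ->
  (forall m, `|u m.+1 - u m| <= ((c * t ^+ m)%:C : CC R)) ->
  exists l : CC R, u @ \oo --> l.
Proof.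
move=> t01 h.
have hRe : cvg ((fun m => complex.Re (u m)) @ \oo).
  apply: (real_geometric_cauchy (c := c) t01) => m; rewrite -lecR; apply: le_trans (h m).
  have := normc_ge_Re (u m.+1 - u m : R[i]).
  by case: (u m.+1) => a b; case: (u m).
have hIm : cvg ((fun m => complex.Im (u m)) @ \oo).
  apply: (real_geometric_cauchy (c := c) t01) => m; rewrite -lecR; apply: le_trans (h m).
  have := normc_ge_Im (u m.+1 - u m).
  by case: (u m.+1) => a b; case: (u m).
exists (lim ((fun m => complex.Re (u m)) @ \oo) +i* lim ((fun m => complex.Im (u m)) @ \oo)).
apply: cvgCP => e e0.
have e2 : 0 < e / 2 by rewrite divr_gt0.
near=> m.
apply: le_trans (norm_le_ReIm _) _; rewrite lecR (splitr e).
have h1 : `|lim ((fun m => complex.Re (u m)) @ \oo) - complex.Re (u m)| <= e / 2.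
  by near: m; move/cvgrPdist_le: hRe; apply.
have h2 : `|lim ((fun m => complex.Im (u m)) @ \oo) - complex.Im (u m)| <= e / 2.
  by near: m; move/cvgrPdist_le: hIm; apply.
move: h1 h2; set a := lim _; set b := lim _.
by case: (u m) => x y /= h1 h2; rewrite lerD.
Unshelve. all: by end_near.
Qed.

Lemma prod_one_plus_le (r : R) K : 0 <= r < 1 ->
  \prod_(1 <= i < K.+1) (1 + (r%:C : CC R) ^+ i) <= (expR ((1 - r)^-1))%:C.
Proof.
move=> /[dup] r01 /andP[r0 r1].
have -> : \prod_(1 <= i < K.+1) (1 + (r%:C : CC R) ^+ i) =
    (\prod_(1 <= i < K.+1) (1 + r ^+ i))%:C.
  rewrite (rmorph_prod (real_complex R)); apply: eq_bigr => i _.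
  by rewrite rmorphD rmorph1 rmorphXn.
rewrite lecR; apply: (@le_trans _ _ (expR (\sum_(i < K.+1) r ^+ i))).
  elim: K => [|K IH]; first by rewrite big_geq // -[leLHS]expR0 ler_expR sumr_ge0 // => i _;
    rewrite exprn_ge0.
  rewrite big_nat_recr //= big_ord_recr /= expRD ler_pM ?expR_ge1Dx //.
    by apply: prodr_ge0 => i _; rewrite addr_ge0 ?exprn_ge0.
  by rewrite addr_ge0 ?exprn_ge0.
by rewrite ler_expR geometric_sum_le.
Qed.
End ComplexLimits.

(** * The constants of the statement *)
Section Constants.
Variables (F : numFieldType) (k : nat).

Lemma prod_pairs4 : \prod_(i < k) \prod_(j < k | (i < j)%N) 4%:R = 2%:R ^+ (k * (k - 1)) :> F.
Proof.
elim: k => [|m IH]; first by rewrite big_ord0 mul0n expr0.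
rewrite big_ord_recr /= [X in _ * X]big1 ?mulr1; last first.
  by move=> j; have := ltn_ord j; lia.
have -> : \prod_(i < m) \prod_(j < m.+1 | (i < j)%N) 4%:R =
    \prod_(i < m) ((\prod_(j < m | (i < j)%N) 4%:R) * 4%:R) :> F.
  apply: eq_bigr => i _; rewrite big_mkcond big_ord_recr /= ltn_ord.
  by rewrite [in RHS]big_mkcond.
rewrite big_split /= IH prodr_const card_ord (_ : 4%:R = 2%:R ^+ 2 :> F); last by ring.
by rewrite -exprM -exprD; congr (_ ^+ _); case: (m) => // j; rewrite !subSS !subn0; lia.
Qed.

(** (2i-1)^2 - (2j-1)^2 = 4 (i-j)(i+j-1). *)
Lemma Ck_discr0 : ratr (Ck k) * (pair_sign F k * discr0 F k) = 1.
Proof.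
rewrite /discr0 (pair_sign_flip (fun i : 'I_k => ((2 * i + 1) ^ 2)%N%:R)) mulrA pair_signK mul1r.
rewrite /Ck fmorphV /=; set X := (X in X^-1 * _).
have XE : X = \prod_(i < k) \prod_(j < k | (i < j)%N)
    (((2 * i + 1) ^ 2)%N%:R - ((2 * j + 1) ^ 2)%N%:R).
  rewrite /X rmorphM rmorphXn rmorph_nat -prod_pairs4 rmorph_prod -big_split.
  apply: eq_bigr => i _ /=; rewrite rmorph_prod -big_split; apply: eq_bigr => j _ /=.
  rewrite ratr_int.
  have -> : (idx i - idx j) * (idx i + idx j - 1) = (i%:Z - j%:Z) * (i + j + 1)%N%:Z.
    by rewrite /idx; lia.
  rewrite rmorphM rmorphB /= -!pmulrn; ring.
rewrite -XE mulVf // XE; apply/prodf_neq0 => i _; apply/prodf_neq0 => j ij.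
rewrite subr_eq0 eqr_nat; nia.
Qed.
Lemma L_lattice_exp (n : {ffun 'I_k -> int}) : L n = (2 * k%:R ^+ 2 - k%:R) / 24 + (lattice_exp n)%:R.
Proof.
rewrite /L; congr (_ + _); rewrite /lattice_exp natr_sum; apply: eq_bigr => i _.
have h : (2 * (node_exp k i (n i))%:Z)%:~R =
    ((2 * k + 1)%N%:Z * n i ^+ 2 + (2 * i + 1)%N%:Z * n i)%:~R :> rat.
  by rewrite node_exp_eq.
rewrite expr2 rmorphD !rmorphM /= -!pmulrn in h.
have -> : (idx i)%:~R = i%:R + 1 :> rat by rewrite /idx -addn1 -pmulrn natrD.
move: h; set e := (node_exp k i (n i))%:R; set x := (n i)%:~R; move=> h.
by apply: (@mulfI _ 2%:R) => //; rewrite h; field.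
Qed.

Lemma eta_exponent : (24^-1 : rat) *+ (2 * k ^ 2 - k)%N = (2 * k%:R ^+ 2 - k%:R) / 24.
Proof.
have hle : (k <= 2 * k ^ 2)%N by rewrite expnS expn1; nia.
by rewrite -[LHS]mulr_natl (natrB _ hle) natrM natrX.
Qed.

End Constants.

(** * Convergence of the product and of the series *)
Section Assembly.
Local Open Scope classical_set_scope.
Local Open Scope complex_scope.
Variables (R : realType) (k : nat) (tau : R[i]).
Hypothesis tau_gt0 : 0 < complex.Im tau.

Let q : CC R := qpow tau 1.
(* A root of q of order w is used so that |q| = t^w splits into t, which gives the rate of
   convergence, and t^(2 k^2 + 2), which lattice_majorant requires. *)
Let w : nat := 2 * (k * k) + 3.
Let s : CC R := qpow tau (w%:R^-1).
Let t' : R := expR (- (2 * pi * complex.Im tau * ratr (w%:R^-1))).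
Let t : CC R := (t'%:C : R[i]).

Lemma w_gt0 : (0 : rat) < w%:R^-1.
Proof. by rewrite invr_gt0 ltr0n /w; lia. Qed.

Lemma t'01 : 0 <= t' < 1.
Proof.
rewrite expR_ge0 /=; have := norm_qpow_lt1 tau_gt0 w_gt0.
by rewrite norm_qpow ltcR.
Qed.

Lemma t01 : 0 <= t < 1.
Proof. by have := t'01; rewrite /t lecR ltcR. Qed.

Lemma q_root : q = s ^+ w.
Proof.
have w0 : (w%:R : rat) != 0 by rewrite pnatr_eq0 /w; lia.
by rewrite /q /s -qpowMn -[X in qpow tau X = _](mulVf w0) mulr_natr.
Qed.

Lemma norm_q : `|q| = t * t ^+ (2 * (k * k) + 2).
Proof.
rewrite q_root normrX -exprS; congr (_ ^+ _); last by rewrite /w; lia.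
by rewrite /s norm_qpow.
Qed.

Let r := t ^+ (2 * (k * k) + 2).
Let U : CC R := ((expR ((1 - t' ^+ (2 * (k * k) + 2))^-1))%:C : R[i]).

Lemma U_bound K : \prod_(1 <= i < K.+1) (1 + r ^+ i) <= U.
Proof.
have /andP[h0 h1] := t'01.
have -> : r = ((t' ^+ (2 * (k * k) + 2))%:C : R[i]) by rewrite rmorphXn.
by apply: prod_one_plus_le; rewrite exprn_ge0 //= exprn_ilt1 //; lia.
Qed.

Lemma eta_prod_qpoch K : eta_prod tau K = (qpoch (CC R) K).[q].
Proof.
rewrite horner_prod; apply: eq_bigr => i _.
by rewrite hornerD hornerN hornerXn hornerC qpow_nat.
Qed.

Lemma norm_eta_prod K : `|eta_prod tau K| <= U.
Proof.
apply: le_trans (U_bound K); have /andP[h0 h1] := t01.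
rewrite normr_prod; apply: ler_prod => i _; rewrite normr_ge0 /=.
apply: le_trans (ler_normB _ _) _; rewrite normr1 lerD2l qpow_nat normrX.
rewrite -/q norm_q -/r lerXn2r ?nnegrE ?mulr_ge0 ?exprn_ge0 //.
by rewrite ler_piMl ?exprn_ge0 // ltW.
Qed.

(** Consecutive products differ by |q|^(m+1) times a bounded factor. *)
Lemma eta_prod_cvg : exists l : CC R, eta_prod tau @ \oo --> l.
Proof.
have /andP[h0 h1] := t01; have /andP[h0' h1'] := t'01.
apply: (@complex_geometric_cauchy R _ (expR ((1 - t' ^+ (2 * (k * k) + 2))^-1)) t' t'01) => m.
have -> : (expR ((1 - t' ^+ (2 * (k * k) + 2))^-1) * t' ^+ m)%:C = U * t ^+ m :> R[i].
  by rewrite rmorphM rmorphXn.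
rewrite [eta_prod tau m.+1]big_nat_recr //= -/(eta_prod tau m).
rewrite (_ : _ - _ = - (eta_prod tau m * qpow tau m.+1%:R)); last by ring.
rewrite normrN normrM ler_pM // ?norm_eta_prod //.
rewrite qpow_nat -/q normrX norm_q.
apply: (@le_trans _ _ (t ^+ m.+1)); last by apply: ler_wiXn2l => //; exact: ltW.
rewrite lerXn2r ?nnegrE ?mulr_ge0 ?exprn_ge0 // ler_piMr // exprn_ile1 //.
exact: ltW.
Qed.

Hypothesis k2 : (2 <= k)%N.

Lemma lattice_sum_cvg (l : CC R) : eta_prod tau @ \oo --> l ->
  partial_sum (lattice_term (k := k) q) @ @totally {ffun 'I_k -> int} -->
  pair_sign (CC R) k * discr0 (CC R) k * l ^+ (k * (2 * k - 1)).
Proof.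
move=> hl; set m := (k * (2 * k - 1))%N; set D := pair_sign _ _ * _.
have /andP[h0 h1] := t01; have /andP[h0' h1'] := t'01.
apply: cvgCP => e e0.
have e2 : 0 < e / 2 by rewrite divr_gt0.
have e2C : (0 : CC R) < ((e / 2)%:C : R[i]) by rewrite ltcR.
pose C : CC R := (tail_const k t + `|discr0 (CC R) k| * U ^+ m) + tail_const k t.
have U0 : 0 <= U by rewrite /U lecR expR_ge0.
have T0 : 0 <= tail_const k t.
  by rewrite mulr_ge0 ?growth_ge0 ?t01 // exprn_ge0 // mulr_ge0 // invr_ge0 subr_ge0 ltW.
have C0 : 0 <= C by rewrite !addr_ge0 // mulr_ge0 ?exprn_ge0.
have CE : C = ((complex.Re C)%:C : R[i]) by rewrite RRe_real // ger0_real.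
have near1 : \forall K \near \oo, `|D * l ^+ m - D * eta_prod tau K ^+ m| <= ((e / 2)%:C : R[i]).
  have hc : (fun K => D * eta_prod tau K ^+ m) @ \oo --> D * l ^+ m.
    apply: cvgM; first exact: cvg_cst.
    elim: (m) => [|m' IH]; first by under eq_fun do rewrite expr0; rewrite expr0; exact: cvg_cst.
    by under eq_fun do rewrite exprS; rewrite exprS; exact: cvgM.
  by move/cvgrPdist_le: hc; apply.
have near2 : \forall K \near \oo, t ^+ K * C <= ((e / 2)%:C : R[i]).
  have hc : (fun K => t' ^+ K * complex.Re C) @ \oo --> (0 : R).
    rewrite -(mul0r (complex.Re C)); apply: cvgM; last exact: cvg_cst.
    by apply: cvg_expr; rewrite ger0_norm.
  move/cvgrPdist_le: hc => /(_ _ e2); apply: filterS => K.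
  rewrite sub0r normrN => h; rewrite CE /t -rmorphXn -rmorphM lecR.
  exact: le_trans (ler_norm _) h.
have [K [hK1 hK2]] : exists K, `|D * l ^+ m - D * eta_prod tau K ^+ m| <= ((e / 2)%:C : R[i])
     /\ t ^+ K * C <= ((e / 2)%:C : R[i]).
  by have [K [? ?]] := filter_ex (filterI near1 near2); exists K.
exists (box k K) => // B /= AB.
have hB : {subset box k K <= B} by move=> n; apply: (fsubsetP AB).
have est := box_estimate t01 norm_q k2 (U_bound K).
have tail := lattice_term_tail t01 norm_q hB.
rewrite -/m -/D -eta_prod_qpoch in est.
rewrite /partial_sum (splitr e) rmorphD /=.
(* Compare with the K-th product, then with the sum over the box, then with the sum over B. *)
rewrite (_ : _ - _ = (D * l ^+ m - D * eta_prod tau K ^+ m) -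
  ((\sum_(n <- box k K) lattice_term q n - D * eta_prod tau K ^+ m) +
   (\sum_(n <- B) lattice_term q n - \sum_(n <- box k K) lattice_term q n))); last by ring.
apply: le_trans (ler_normB _ _) _; apply: lerD => //.
apply: le_trans hK2; apply: le_trans (ler_normD _ _) _.
by rewrite /C mulrDr lerD.
Qed.

Lemma term_sum_cvg (l : CC R) : eta_prod tau @ \oo --> l ->
  partial_sum (fun n : {ffun 'I_k -> int} =>
    (-1) ^ (\sum_(i < k) n i) * (chiD n)%:~R * qpow tau (L n) : CC R) @ @totally _ -->
  qpow tau ((2 * k%:R ^+ 2 - k%:R) / 24) * (pair_sign (CC R) k * discr0 (CC R) k * l ^+ (k * (2 * k - 1))).
Proof.
move=> hl; set term := (fun n : {ffun 'I_k -> int} => _).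
have -> : partial_sum term = (fun A =>
    qpow tau ((2 * k%:R ^+ 2 - k%:R) / 24) * partial_sum (lattice_term (k := k) q) A).
  apply/funext => A; rewrite /partial_sum mulr_sumr; apply: eq_bigr => n _.
  by rewrite /term /lattice_term L_lattice_exp qpowD qpow_nat -/q; ring.
by apply: cvgM; [exact: cvg_cst | exact: lattice_sum_cvg].
Qed.
End Assembly.

Theorem theorem1p1 (R : realType) (k : nat) (tau : R[i])
    (hk : (2 <= k)%N) (htau : 0 < complex.Im tau) :
  let term (n : {ffun 'I_k -> int}) : CC R :=
    (-1) ^ (\sum_(i < k) n i) * (chiD n)%:~R * qpow tau (L n) in
  csummable term /\
  eta tau ^+ (2 * k ^ 2 - k)%N = ratr (Ck k) * csum term.
Proof.
move=> term; have [l hl] := @eta_prod_cvg R k tau htau.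
have hterm := term_sum_cvg htau hk hl.
split; first by apply/cvg_ex; eexists; exact: hterm.
rewrite /csum (cvg_lim _ hterm); last exact: norm_hausdorff.
rewrite /eta (cvg_lim _ hl); last exact: norm_hausdorff.
rewrite exprMn -qpowMn eta_exponent.
have -> : (2 * k ^ 2 - k = k * (2 * k - 1))%N by rewrite expnS expn1; nia.
by rewrite -[LHS]mul1r -(Ck_discr0 (CC R) k); ring.
Qed.
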